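(* Let $\gamma$ be a smooth strictly convex closed curve in the plane. For integers $p,q\ge1$ with $2p<q$ let $Q_{p,q}$ be the minimal area of the $q$-gons with rotation number $p$ circumscribed about $\gamma$. Then for all relatively prime positive integers $p,q$ with $2p<q-1$, $$Q_{p,q-1}+Q_{p,q+1}>2Q_{p,q}.$$
   Context: Orient $\gamma$ counterclockwise and for $\theta\in\mathbb{R}$ let $\gamma(\theta)$ be the point of $\gamma$ whose oriented tangent line $\ell(\theta)$ has direction $(\cos\theta,\sin\theta)$; so $\gamma(\theta+2\pi)=\gamma(\theta)$. A circumscribed $q$-gon with rotation number $p$ is given by real numbers $\theta_0\le\theta_1\le\dots\le\theta_q=\theta_0+2\pi p$ with $0\le\theta_{i+1}-\theta_i<\pi$; its vertices are $A_i=\ell(\theta_i)\cap\ell(\theta_{i+1})$, $i=0,\dots,q-1$ (with $A_i=\gamma(\theta_i)$ if $\theta_{i+1}=\theta_i$), in cyclic order. It may be star-shaped. Its area is the algebraic area (counted with winding numbers) $\frac12\sum_{i}\det(A_i,A_{i+1})$, indices mod $q$. The integers $p,q$ in the definition of $Q_{p,q}$ need not be relatively prime. *)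

(* Defs.v *)
From HB Require Import structures.
From mathcomp Require Import all_boot all_order all_algebra.
From mathcomp Require Import all_classical all_reals all_analysis.
Set Implicit Arguments.
Unset Strict Implicit.
Unset Printing Implicit Defensive.
Import Order.TTheory GRing.Theory Num.Theory.
Import numFieldNormedType.Exports.
Local Open Scope classical_set_scope.
Local Open Scope ring_scope.

Definition det2 (R : realType) (u v : R * R) : R := u.1 * v.2 - u.2 * v.1.

Definition dir (R : realType) (theta : R) : R * R := (cos theta, sin theta).

(* Strict convexity and the counterclockwise orientation are expressed together
   by [scc_convex]: each tangent line meets the curve only at its point of
   tangency, and the rest of the curve lies on its left.  The curvature is
   allowed to vanish at some points. *)
Record smooth_strictly_convex_closed (R : realType) (c : R -> R * R) (T : R)
    : Prop := {
  scc_period_gt0 : 0 < T ;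
  scc_closed : forall t, c (t + T) = c t ;
  scc_simple : forall s t : R, 0 <= s < T -> 0 <= t < T -> c s = c t -> s = t ;
  scc_smooth : forall (n : nat) (t : R), derivable (derive1n n c) t 1 ;
  scc_regular : forall t, derive1 c t != 0 ;
  scc_convex : forall s t, c s <> c t -> 0 < det2 (derive1 c t) (c s - c t) }.

Definition tangency_points (R : realType) (c : R -> R * R) (theta : R)
    : set (R * R) :=
  [set P | exists t, P = c t /\
                     exists r : R, 0 < r /\ derive1 c t = r *: dir theta].

(* For a smooth strictly convex closed curve, [tangency_points c theta] is a
   singleton, so the default value of [xget] plays no role. *)
Definition gamma (R : realType) (c : R -> R * R) (theta : R) : R * R :=
  xget 0 (tangency_points c theta).

Definition tangent_line (R : realType) (c : R -> R * R) (theta : R)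
    : set (R * R) :=
  [set P | det2 (dir theta) (P - gamma c theta) = 0].

Definition is_vertex (R : realType) (c : R -> R * R) (a b : R) (A : R * R)
    : Prop :=
  if a == b then A = gamma c a
  else (tangent_line c a `&` tangent_line c b) A.

(* Only the values [theta i] for [i <= q] and [A i] for [i < q] matter. *)
Record circumscribed (R : realType) (c : R -> R * R) (p q : nat)
    (theta : nat -> R) (A : nat -> R * R) : Prop := {
  circ_step : forall i, (i < q)%N -> 0 <= theta i.+1 - theta i < pi ;
  circ_rotation : theta q = theta 0%N + 2 * pi * p%:R ;
  circ_vertex : forall i, (i < q)%N -> is_vertex c (theta i) (theta i.+1) (A i) }.

Definition algebraic_area (R : realType) (q : nat) (A : nat -> R * R) : R :=
  2^-1 * \sum_(i < q) det2 (A i) (A (i.+1 %% q)%N).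

Definition circumscribed_areas (R : realType) (c : R -> R * R) (p q : nat)
    : set R :=
  [set a | exists theta A, circumscribed c p q theta A /\
                           a = algebraic_area q A].

Definition is_minimum (R : realType) (S : set R) (m : R) : Prop :=
  S m /\ lbound S m.

(* Main.v *)
Require Import Defs.
From HB Require Import structures.
From mathcomp Require Import all_boot all_order all_algebra.
From mathcomp Require Import all_classical all_reals all_analysis.
From mathcomp Require Import ring lra zify.
Set Implicit Arguments.
Unset Strict Implicit.
Unset Printing Implicit Defensive.
Import Order.TTheory GRing.Theory Num.Theory.
Import numFieldNormedType.Exports.
Local Open Scope classical_set_scope.
Local Open Scope ring_scope.

(** Write h for the support function of the curve.  The area of a circumscribed
polygon is the sum over i of a two-point function G(theta_i, theta_{i+1}) of
the tangent directions, so Q_{p,q} is the least action of a periodic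
Frenkel-Kontorova type chain.  Replacing nested intervals [a, b], [a', b'] with
a <= a' <= b' <= b by the crossing ones [a, b'], [a', b] lowers the action,
strictly if a < a' and b' < b, because a fixed tangent cuts off the larger
triangle from the larger interval.

Take minimal chains x for (p, q-1) and y for (p, q+1).  By pigeonhole some step
[x_0, x_1] of x contains, after renumbering, a step [y_1, y_2] of y, where
y_0 < x_0 <= y_1 and y_2 < x_1.  Exchanging these two steps and then crossing
the tails once more produces two closed chains for (p, q) whose total action is
at most that of x and y.  The gain is strict if x_0 < y_1.  If x_0 = y_1, one of
the new chains leaves y_1 in a different direction than y does while arriving
there from the same point y_0; by the first-order condition at y_1, which needs
the differentiability of h, it is not minimal.

Minima exist because the action tends to infinity when a step approaches pi. *)

(** * The area as a sum over consecutive tangents *)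

(* Half of [h a * v - h b * u], where [v] and [u] are the coordinates of the
   vertex along the tangents of directions [a] and [b].  On the diagonal the
   division by [sin 0] gives 0, which is the right value. *)
Definition link (R : realType) (h : R -> R) (a b : R) : R :=
  (2 * h a * h b - (h a ^+ 2 + h b ^+ 2) * cos (b - a)) / (2 * sin (b - a)).

(* Positive iff the tangent of direction [m] cuts off the vertex of the tangents
   of directions [a] and [b]; [cut_area] is then the area of the triangle it
   cuts off. *)
Definition sine_gap (R : realType) (h : R -> R) (a m b : R) : R :=
  h a * sin (b - m) + h b * sin (m - a) - h m * sin (b - a).

(** Strict convexity relative to sinusoids: at [m] the function lies below the combination of [cos]
    and [sin] that agrees with it at [a] and [b]. *)
Definition sine_convex (R : realType) (h : R -> R) : Prop :=
  forall a m b, a < m -> m < b -> b - a < pi -> 0 < sine_gap h a m b.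

Lemma sinB_gt0 (R : realType) (a b : R) : a < b -> b - a < pi -> 0 < sin (b - a).
Proof. by move=> ab bapi; apply: sin_gt0_pi; rewrite subr_gt0 ab. Qed.

Lemma link_diag (R : realType) (h : R -> R) (a : R) : link h a a = 0.
Proof. by rewrite /link subrr sin0 mulr0 invr0 mulr0. Qed.

Definition cut_area (R : realType) (h : R -> R) (a m b : R) : R :=
  sine_gap h a m b ^+ 2 / (2 * sin (b - a) * sin (m - a) * sin (b - m)).

Lemma link_cut (R : realType) (h : R -> R) (a m b : R) :
    a < m -> m < b -> b - a < pi ->
  link h a b - link h a m - link h m b = cut_area h a m b.
Proof.
move=> am mb bapi.
have sp : 0 < sin (m - a) by apply: sinB_gt0 => //; lra.
have sq : 0 < sin (b - m) by apply: sinB_gt0 => //; lra.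
have ss : 0 < sin (b - a) by apply: sinB_gt0 => //; lra.
move: ss; rewrite /cut_area /sine_gap /link.
have -> : b - a = (m - a) + (b - m) by lra.
move: (m - a) (b - m) sp sq => p q; rewrite (sinD p q) (cosD p q).
have := cos2Dsin2 p; have := cos2Dsin2 q.
move: (h a) (h m) (h b) (sin p) (cos p) (sin q) (cos q).
move=> x y z sp cp sq cq eq ep sp0 sq0 s0.
apply/eqP; rewrite -subr_eq0; apply/eqP.
have p1 : sp != 0 by rewrite gt_eqF.
have p2 : sq != 0 by rewrite gt_eqF.
have p3 : sp * cq + cp * sq != 0 by rewrite gt_eqF.
set D := 2 * (sp * cq + cp * sq) * sp * sq.
(* The difference is a combination of the two Pythagorean relations, with these cofactors. *)
transitivity ((x ^+ 2 * sq ^+ 2 * (cp ^+ 2 + sp ^+ 2 - 1)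
              + z ^+ 2 * sp ^+ 2 * (cq ^+ 2 + sq ^+ 2 - 1)) / D).
  by rewrite /D; field; rewrite p1 p2 p3.
by rewrite eq ep !subrr !mulr0 addr0 mul0r.
Qed.

Lemma cut_area_gt0 (R : realType) (h : R -> R) (a m b : R) : sine_convex h ->
  a < m -> m < b -> b - a < pi -> 0 < cut_area h a m b.
Proof.
move=> hh am mb bapi; rewrite divr_gt0 ?exprn_gt0 ?hh //.
by rewrite !mulr_gt0 ?sinB_gt0 //; lra.
Qed.

(** The triangle of [cut_area] has on the tangent of direction [m] a side of length [sine_gap h a m
    b / (sin (m - a) * sin (b - m))]. Divided by the sines, the identity shows that this side grows
    with [b] when [h] is sine-convex. *)
Lemma sine_gap_slopel (R : realType) (h : R -> R) (a m b b' : R) :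
  sine_gap h a m b * sin (b' - m) - sine_gap h a m b' * sin (b - m)
  = sin (m - a) * sine_gap h m b' b.
Proof.
rewrite /sine_gap.
have -> : b - a = (m - a) + ((b' - m) + (b - b')) by lra.
have -> : b' - a = (m - a) + (b' - m) by lra.
have -> : b - m = (b' - m) + (b - b') by lra.
move: (m - a) (b' - m) (b - b') => p q r.
rewrite !(sinD p) (sinD q) (cosD q).
have := cos2Dsin2 q; have := cos2Dsin2 p.
move: (sin p) (cos p) (sin q) (cos q) (sin r) (cos r) => sp cp sq cq sr cr ep eq.
have {}ep : cp ^+ 2 = 1 - sp ^+ 2 by lra.
have {}eq : cq ^+ 2 = 1 - sq ^+ 2 by lra.
by ring: ep eq.
Qed.

(** The same for the side on the tangent of direction [a], of length [sine_gap h a m b / (sin (m -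
    a) * sin (b - a))]. *)
Lemma sine_gap_sloper (R : realType) (h : R -> R) (a m b b' : R) :
  sine_gap h a m b * sin (b' - a) - sine_gap h a m b' * sin (b - a)
  = sin (m - a) * sine_gap h a b' b.
Proof.
rewrite /sine_gap.
have -> : b - a = (m - a) + ((b' - m) + (b - b')) by lra.
have -> : b' - a = (m - a) + (b' - m) by lra.
have -> : b - m = (b' - m) + (b - b') by lra.
move: (m - a) (b' - m) (b - b') => p q r.
rewrite !(sinD p) (sinD q) (cosD q).
have := cos2Dsin2 q; have := cos2Dsin2 p.
move: (sin p) (cos p) (sin q) (cos q) (sin r) (cos r) => sp cp sq cq sr cr ep eq.
have {}ep : cp ^+ 2 = 1 - sp ^+ 2 by lra.
have {}eq : cq ^+ 2 = 1 - sq ^+ 2 by lra.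
by ring: ep eq.
Qed.


(** The area is half the product of [sin (m - a)] and the sides on the tangents of directions [a]
    and [m], and both sides grow with [b]. *)
Lemma cut_area_lt (R : realType) (h : R -> R) (a m b b' : R) : sine_convex h ->
  a < m -> m < b' -> b' < b -> b - a < pi -> cut_area h a m b' < cut_area h a m b.
Proof.
move=> hh am mb' b'b bapi.
have s1 : 0 < sin (b - a) by apply: sinB_gt0; lra.
have s2 : 0 < sin (m - a) by apply: sinB_gt0; lra.
have s3 : 0 < sin (b - m) by apply: sinB_gt0; lra.
have s4 : 0 < sin (b' - a) by apply: sinB_gt0; lra.
have s5 : 0 < sin (b' - m) by apply: sinB_gt0; lra.
have k0 : 0 < sine_gap h a m b by apply: hh; lra.
have k1 : 0 < sine_gap h a m b' by apply: hh; lra.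
have k2 : 0 < sine_gap h m b' b by apply: hh; lra.
have k3 : 0 < sine_gap h a b' b by apply: hh; lra.
have /(congr1 (fun x => 0 < x)) := sine_gap_slopel h a m b b'.
have /(congr1 (fun x => 0 < x)) := sine_gap_sloper h a m b b'.
rewrite !mulr_gt0 // !subr_gt0 => ra rm.
rewrite /cut_area.
rewrite ltr_pdivrMr ?mulr_gt0 // mulrAC ltr_pdivlMr ?mulr_gt0 //.
move: ra rm s1 s2 s3 s4 s5 k0 k1.
move: (sine_gap h a m b) (sine_gap h a m b') => K K'.
move: (sin _) (sin _) (sin _) (sin _) (sin _) => u v w r t.
move=> ra rm ? ? ? ? ? ? ?.
have : (K' * t) * (K' * w) < (K * r) * (K * v).
  by apply: ltr_pM => //; apply/ltW/mulr_gt0.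
rewrite -(ltr_pM2l (_ : 0 < 2 * u)) ?mulr_gt0 //.
by congr (_ < _); ring.
Qed.

(** By [link_cut] the gain is the difference of the areas that the tangent of direction [a'] cuts
    off for [[a, b]] and for [[a, b']]. If [a' = b'] it is a single cut area. *)
Lemma link_monge_lt (R : realType) (h : R -> R) (a a' b' b : R) : sine_convex h ->
    a < a' -> a' <= b' -> b' < b -> b - a < pi ->
  link h a b' + link h a' b < link h a b + link h a' b'.
Proof.
move=> hh aa'; rewrite le_eqVlt => /orP[/eqP <-|a'b'] b'b bapi.
  have := link_cut h aa' b'b bapi; have := cut_area_gt0 hh aa' b'b bapi.
  by rewrite link_diag; lra.
have := cut_area_lt hh aa' a'b' b'b bapi.
by rewrite -!link_cut //; lra.
Qed.

Lemma link_monge (R : realType) (h : R -> R) (a a' b' b : R) : sine_convex h ->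
    a <= a' -> a' <= b' -> b' <= b -> b - a < pi ->
  link h a b' + link h a' b <= link h a b + link h a' b'.
Proof.
move=> hh; rewrite le_eqVlt => /orP[/eqP <-|aa'] a'b'; first by move=> *; rewrite addrC lexx.
rewrite le_eqVlt => /orP[/eqP -> //|b'b bapi]; exact/ltW/link_monge_lt.
Qed.

(** * Crossing the tails of two chains *)

Definition steps (R : realType) (n : nat) (x : nat -> R) : Prop :=
  forall i, (i < n)%N -> 0 <= x i.+1 - x i < pi.

Definition cost (R : realType) (h : R -> R) (n : nat) (x : nat -> R) : R :=
  \sum_(i < n) link h (x i) (x i.+1).

Lemma costS (R : realType) (h : R -> R) n x :
  cost h n.+1 x = link h (x 0%N) (x 1%N) + cost h n (fun i => x i.+1).
Proof. by rewrite /cost big_ord_recl. Qed.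

Definition ncons1 (R : realType) (a : R) (x : nat -> R) (i : nat) : R :=
  if i is j.+1 then x j else a.

(** Follow both chains up to the first step after which [f] is no longer behind [g]: there the steps
    are nested, and [link_monge] allows the tails to be exchanged. The clause on index 1 serves the
    equality case of [splice_nested]. *)
Lemma swap_tails (R : realType) (h : R -> R) n (f g : nat -> R) :
    sine_convex h -> steps n f -> steps n g ->
    f 0%N <= g 0%N -> g n <= f n ->
  exists f' g', [/\ steps n f', steps n g', cost h n f' + cost h n g' <= cost h n f + cost h n g &
    [/\ f' 0%N = f 0%N, g' 0%N = g 0%N, f' n = g n, g' n = f n &
     (0 < n)%N -> f' 1%N = f 1%N \/ f' 1%N = g 1%N]].
Proof.
move=> hh; elim: n f g => [|n IH] f g sf sg fg gf.
  by exists f, g; split=> //; split=> //; lra.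
have f01 := sf 0%N isT; have g01 := sg 0%N isT.
have sf' : steps n (fun i => f i.+1) by move=> i /(sf i.+1).
have sg' : steps n (fun i => g i.+1) by move=> i /(sg i.+1).
have [gf1|fg1] := leP (g 1%N) (f 1%N).
  exists (ncons1 (f 0%N) (fun i => g i.+1)), (ncons1 (g 0%N) (fun i => f i.+1)).
  split.
  - by move=> [|i] // ?; [rewrite /=; lra | exact: sg].
  - by move=> [|i] // ?; [rewrite /=; lra | exact: sf].
  - rewrite !costS /=.
    suff: link h (f 0%N) (g 1%N) + link h (g 0%N) (f 1%N) <=
      link h (f 0%N) (f 1%N) + link h (g 0%N) (g 1%N).
      by move: (cost h n _) (cost h n _) => A B; lra.
    by apply: link_monge => //; lra.
  by split=> //; right.
have [f' [g' [sf1 sg1 c1 [e0 e1 e2 e3 _]]]] := IH _ _ sf' sg' (ltW fg1) gf.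
exists (ncons1 (f 0%N) f'), (ncons1 (g 0%N) g'); split.
- by move=> [|i] // ?; [rewrite /= e0 | exact: sf1].
- by move=> [|i] // ?; [rewrite /= e1 | exact: sg1].
- rewrite !costS /= e0 e1; move: c1.
  by move: (cost h n _) (cost h n _) (cost h n _) (cost h n _) => A B C D; lra.
by split=> //; left.
Qed.

(** * First-order condition *)

Lemma link_sym (R : realType) (h : R -> R) (a b : R) : link h a b = - link h b a.
Proof.
rewrite /link -(opprB b a) cosN sinN mulrN invrN mulrN opprK.
by congr (_ / _); ring.
Qed.

(* The coordinate along the tangent of direction [a], measured from the foot of
   the perpendicular from the origin, of its intersection with the tangent of
   direction [b]. *)
Definition side (R : realType) (h : R -> R) (a b : R) : R :=
  (h b - h a * cos (b - a)) / sin (b - a).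

Lemma is_derive1M (R : realType) (f g : R -> R) (x a b : R) :
    is_derive x 1 f a -> is_derive x 1 g b ->
  is_derive x 1 (fun t => f t * g t) (f x * b + g x * a).
Proof. by move=> df dg; exact: (@is_deriveM R R f g x 1 a b df dg). Qed.

Lemma is_derive1D (R : realType) (f g : R -> R) (x a b : R) :
    is_derive x 1 f a -> is_derive x 1 g b ->
  is_derive x 1 (fun t => f t + g t) (a + b).
Proof. by move=> df dg; exact: (@is_deriveD R R R f g x 1 a b df dg). Qed.

Lemma is_derive1B (R : realType) (f g : R -> R) (x a b : R) :
    is_derive x 1 f a -> is_derive x 1 g b ->
  is_derive x 1 (fun t => f t - g t) (a - b).
Proof. by move=> df dg; exact: (@is_deriveB R R R f g x 1 a b df dg). Qed.

Lemma is_derive1V (R : realType) (f : R -> R) (x a : R) :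
    f x != 0 -> is_derive x 1 f a ->
  is_derive x 1 (fun t => (f t)^-1) (- f x ^- 2 * a).
Proof. by move=> f0 df; exact: (@is_deriveV R f x a 1 f0 df). Qed.

Lemma is_derive1C (R : realType) (a x : R) : is_derive x 1 (fun=> a) (0 : R).
Proof. exact: (@is_derive_cst R R R a x 1). Qed.

Lemma is_derive_link (R : realType) (h : R -> R) (t b e : R) :
    sin (b - t) != 0 -> is_derive t 1 h e ->
  is_derive t 1 (fun s => link h s b)
    (e * side h t b - (side h t b ^+ 2 + h t ^+ 2) / 2).
Proof.
move=> s0 dh.
have dB : is_derive t 1 (fun s : R => b - s) (0 - 1).
  exact: is_derive1B (is_derive1C _ _) (is_derive_id _ _).
have dC : is_derive t 1 (fun s : R => cos (b - s)) (- sin (b - t) * (0 - 1)).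
  exact: (@is_derive1_comp R cos (fun s => b - s) t _ _ (is_derive_cos _) dB).
have dS : is_derive t 1 (fun s : R => sin (b - s)) (cos (b - t) * (0 - 1)).
  exact: (@is_derive1_comp R sin (fun s => b - s) t _ _ (is_derive_sin _) dB).
have dh2 := is_derive1D (is_derive1M dh dh) (is_derive1C (h b ^+ 2) t).
have dN := is_derive1B (is_derive1M (is_derive1C (2 * h b) t) dh) (is_derive1M dh2 dC).
have dD := is_derive1M (is_derive1C 2 t) dS.
have d0 : 2 * sin (b - t) != 0 by rewrite mulf_neq0.
have dF := is_derive1M dN (@is_derive1V R (fun s : R => 2 * sin (b - s)) t _ d0 dD).
rewrite (_ : (fun s => _) = (fun s => (2 * h b * h s -
    (h s * h s + h b ^+ 2) * cos (b - s)) * (2 * sin (b - s))^-1)); last first.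
  by apply/funext => s; rewrite /link; congr (_ / _); ring.
apply: (is_derive_eq dF).
rewrite /side.
have := cos2Dsin2 (b - t).
move: s0; move: (sin (b - t)) (cos (b - t)) (h t) (h b) => s c x y s0 cs.
have {}cs : c ^+ 2 = 1 - s ^+ 2 by lra.
by field: cs; rewrite s0.
Qed.

(* Up to terms independent of [b], this is [- (side h t b - e t) ^+ 2 / 2]. *)
Definition link_slope (R : realType) (h e : R -> R) (t b : R) : R :=
  e t * side h t b - (side h t b ^+ 2 + h t ^+ 2) / 2.

(* The second condition says that the tangent of direction [b] does not pass
   through the tangency point of direction [t]. *)
Definition tangential (R : realType) (h e : R -> R) : Prop :=
  (forall t : R, is_derive t 1 h (e t)) /\
  forall t b, t < b -> b - t < pi ->
    h t * cos (b - t) + e t * sin (b - t) < h b.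

(** As [link] is antisymmetric, the sum equals [link h s b - link h s a], whose derivative in [s] is
    a difference of slopes. For a support function the conclusion says that the tangency point
    bisects its side. *)
Lemma local_min_link_slope (R : realType) (h e : R -> R) (a t b : R) :
    (forall s : R, is_derive s 1 h (e s)) ->
    a < t -> t < b -> t - a < pi -> b - t < pi ->
    (forall s, a < s -> s < b -> s - a < pi -> b - s < pi ->
       link h a t + link h t b <= link h a s + link h s b) ->
  link_slope h e t b = link_slope h e t a.
Proof.
move=> dh at_ tb tapi btpi tmin.
have dF s : a < s -> s < b -> s - a < pi -> b - s < pi ->
    is_derive s 1 (fun s => link h s b - link h s a)
      (link_slope h e s b - link_slope h e s a).
  move=> as_ sb sapi bspi.
  apply: is_derive1B; apply: is_derive_link => //.
    by rewrite gt_eqF // sinB_gt0.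
  by rewrite -(opprB s) sinN oppr_eq0 gt_eqF // sinB_gt0.
(* On this interval [s] stays between [a] and [b] and closer than [pi] to both. *)
set l := Num.max a (b - pi); set u := Num.min b (a + pi).
have lt_u : l < t < u by rewrite /l /u gt_max lt_min; lra.
have inE s : s \in `]l, u[ -> [/\ a < s, s < b, s - a < pi & b - s < pi].
  by rewrite in_itv /= /l /u gt_max lt_min => /andP[/andP[? ?] /andP[? ?]]; split=> //; lra.
have d0 : is_derive t 1 (fun s => link h s b - link h s a) 0.
  apply: (@derive1_at_min R _ l u).
  - by lra.
  - by move=> s /inE[? ? ? ?]; case: (dF s).
  - by rewrite in_itv /=; lra.
  - move=> s /inE[? ? ? ?]; have := tmin s; rewrite !(link_sym h a).
    by move=> /(_ _ _ _ _); lra.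
have [_ d1] := dF t at_ tb tapi btpi; have [_ d2] := d0.
by apply/eqP; rewrite -subr_eq0 -d1 d2.
Qed.

Lemma side_lt (R : realType) (h : R -> R) (t b b' : R) : sine_convex h ->
  t < b -> b < b' -> b' - t < pi -> side h t b < side h t b'.
Proof.
move=> hh tb bb' btpi.
have s1 : 0 < sin (b - t) by apply: sinB_gt0; lra.
have s2 : 0 < sin (b' - t) by apply: sinB_gt0; lra.
rewrite /side ltr_pdivrMr // mulrAC ltr_pdivlMr //.
have := hh t b b' tb bb' btpi; rewrite /sine_gap.
have -> : b' - b = (b' - t) - (b - t) by lra.
by rewrite sinB; lra.
Qed.

(** The coordinate [side h t b] lies beyond [e t] and increases with [b], hence so does its squared
    distance to [e t]. Thus the slope determines the next direction. *)
Lemma link_slope_lt (R : realType) (h e : R -> R) (t b b' : R) :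
    sine_convex h -> tangential h e -> t < b -> b < b' -> b' - t < pi ->
  link_slope h e t b' < link_slope h e t b.
Proof.
move=> hh [_ he] tb bb' btpi.
have sl := side_lt hh tb bb' btpi.
have e0 : e t < side h t b.
  by rewrite /side ltr_pdivlMr ?sinB_gt0; first by [have := he t b tb; lra]; lra.
rewrite /link_slope.
suff : 0 < (side h t b' - side h t b) * ((side h t b' - e t) + (side h t b - e t)).
  by lra.
by rewrite mulr_gt0; lra.
Qed.

(** * Chains of tangent directions *)

Definition config (R : realType) (p q : nat) (x : nat -> R) : Prop :=
  steps q x /\ x q = x 0%N + 2 * pi * p%:R.

Definition is_minimal (R : realType) (h : R -> R) (p q : nat) (x : nat -> R) : Prop :=
  config p q x /\ forall y, config p q y -> cost h q x <= cost h q y.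

(** Unlike a [config], such an infinite chain can be renumbered from any index. *)
Definition periodic_steps (R : realType) (p q : nat) (x : nat -> R) : Prop :=
  (forall i, 0 <= x i.+1 - x i < pi) /\
  forall i, x (i + q)%N = x i + 2 * pi * p%:R.

Lemma eq_cost (R : realType) (h : R -> R) n (x y : nat -> R) :
  (forall i, (i <= n)%N -> x i = y i) -> cost h n x = cost h n y.
Proof. by move=> xy; apply: eq_bigr => i _; rewrite !xy // ltnW. Qed.

Lemma costSr (R : realType) (h : R -> R) n (x : nat -> R) :
  cost h n.+1 x = cost h n x + link h (x n) (x n.+1).
Proof. by rewrite /cost big_ord_recr. Qed.

Lemma config_periodic (R : realType) p q (x : nat -> R) : (0 < q)%N ->
    config p q x ->
  exists2 y : nat -> R, periodic_steps p q y & forall i, (i <= q)%N -> y i = x i.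
Proof.
move=> q0 [sx xq].
exists (fun i => x (i %% q)%N + 2 * pi * p%:R * (i %/ q)%:R).
  split=> i; last by rewrite modnDr divnDr ?dvdnn // divnn q0 addn1 -natr1; ring.
  have := sx (i %% q)%N (ltn_pmod i q0).
  have := divn_eq i q; have := ltn_pmod i q0.
  move: (i %% q)%N (i %/ q)%N => r k rq ->.
  have [rq1|rq1] := ltnP r.+1 q.
    by rewrite -addnS modnMDl divnMDl // modn_small // divn_small // addn0; lra.
  (* The last step of a period: the next index opens the following period, and the value of [x q]
     joins them. *)
  have -> : (k * q + r).+1 = (k.+1 * q)%N by lia.
  rewrite modnMl mulnK // -natr1.
  by have -> : r.+1 = q by [lia]; rewrite xq; lra.
move=> i; rewrite leq_eqVlt => /orP[/eqP ->|iq].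
  by rewrite modnn divnn q0 xq mulr1n mulr1.
by rewrite modn_small // divn_small // mulr0 addr0.
Qed.

Lemma periodic_mono (R : realType) p q (x : nat -> R) (i j : nat) :
  periodic_steps p q x -> (i <= j)%N -> x i <= x j.
Proof.
move=> [sx _]; move=> ij; rewrite -(subnKC ij); elim: (j - i)%N => [|k IH].
  by rewrite addn0.
by rewrite addnS; have := sx (i + k)%N; lra.
Qed.

Lemma periodic_shift (R : realType) p q (x : nat -> R) k :
  periodic_steps p q x -> periodic_steps p q (fun i => x (i + k)%N).
Proof. by move=> [sx xq]; split=> i; [exact: sx|rewrite addnAC xq]. Qed.

Lemma periodic_config (R : realType) p q (x : nat -> R) :
  periodic_steps p q x -> config p q x.
Proof. by move=> [sx xq]; split=> [i _ //|]; rewrite -(add0n q) xq. Qed.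

Lemma link_period (R : realType) (h : R -> R) (p : nat) (a b : R) :
    (forall t, h (t + 2 * pi) = h t) ->
  link h (a + 2 * pi * p%:R) (b + 2 * pi * p%:R) = link h a b.
Proof.
move=> hper.
have hp t : h (t + 2 * pi * p%:R) = h t.
  elim: p => [|p IH]; first by rewrite mulr0 addr0.
  by rewrite -[p.+1%:R]natr1 mulrDr mulr1 addrA hper.
rewrite /link !hp.
by have -> : b + 2 * pi * p%:R - (a + 2 * pi * p%:R) = b - a by lra.
Qed.

(** A shift by one moves the first link to the end, translated by a multiple of [2 * pi]. *)
Lemma cost_shift (R : realType) (h : R -> R) p q (x : nat -> R) k :
    (forall t, h (t + 2 * pi) = h t) -> periodic_steps p q x ->
  cost h q (fun i => x (i + k)%N) = cost h q x.
Proof.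
move=> hper; elim: k x => [|k IH] x px.
  by apply: eq_cost => i _; rewrite addn0.
rewrite -[RHS](IH _ px).
case: q px IH => [|q] px IH; first by rewrite /cost !big_ord0.
rewrite costSr costS addrC; congr (_ + _).
  have [_ xq] := px.
  have -> : (q.+1 + k.+1 = k.+1 + q.+1)%N by lia.
  have -> : (q + k.+1 = k + q.+1)%N by lia.
  by rewrite !xq link_period.
by apply: eq_cost => i _; rewrite addnS.
Qed.

Lemma minimal_shift (R : realType) (h : R -> R) p q (x : nat -> R) k :
    (forall t, h (t + 2 * pi) = h t) -> periodic_steps p q x ->
  is_minimal h p q x -> is_minimal h p q (fun i => x (i + k)%N).
Proof.
move=> hper px [_ mx]; split; first exact/periodic_config/periodic_shift.
by move=> y /mx; rewrite (cost_shift _ hper px).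
Qed.

Definition update1 (R : realType) (x : nat -> R) (s : R) : nat -> R :=
  fun i => if i == 1%N then s else x i.

Lemma minimal_update1 (R : realType) (h : R -> R) p n (x : nat -> R) s :
    is_minimal h p n.+2 x -> x 0%N <= s -> s <= x 2%N ->
    s - x 0%N < pi -> x 2%N - s < pi ->
  link h (x 0%N) (x 1%N) + link h (x 1%N) (x 2%N)
    <= link h (x 0%N) s + link h s (x 2%N).
Proof.
move=> [[sx xq] mx] x0s sx2 x0spi sx2pi.
(* Index 1 is interior, so the rotation condition is untouched. *)
have : config p n.+2 (update1 x s).
  split=> [[|[|i]] iq|]; rewrite /update1 /=.
  - by lra.
  - by lra.
  - exact: (sx i.+2).
  - exact: xq.
move=> /mx; rewrite !costS /update1 /=.
by rewrite [leRHS]addrA [leLHS]addrA lerD2r.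
Qed.

(** If [x 1 = x 2], one copy of this tangent can be moved to the midpoint of [[x 0, x 1]], where it
    cuts off a corner and lowers the cost. *)
Lemma minimal_strict (R : realType) (h : R -> R) p n (x : nat -> R) :
    sine_convex h -> is_minimal h p n.+2 x -> x 0%N < x 1%N -> x 1%N < x 2%N.
Proof.
move=> hh mx x01; have [[sx _] _] := mx.
have s0 := sx 0%N isT; have s1 := sx 1%N isT.
rewrite ltNge; apply/negP => x21.
have x12 : x 2%N = x 1%N by lra.
set s := (x 0%N + x 1%N) / 2.
have l0 : x 0%N < s by rewrite /s; lra.
have l1 : s < x 1%N by rewrite /s; lra.
have l2 : x 1%N - x 0%N < pi by lra.
have := link_cut h l0 l1 l2; have := cut_area_gt0 hh l0 l1 l2.
have : link h (x 0%N) (x 1%N) + link h (x 1%N) (x 2%N)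
    <= link h (x 0%N) s + link h s (x 2%N).
  by apply: (minimal_update1 mx); lra.
by rewrite x12 link_diag; lra.
Qed.

Lemma minimal_link_slope (R : realType) (h e : R -> R) p n (x : nat -> R) :
    tangential h e -> is_minimal h p n.+2 x -> x 0%N < x 1%N -> x 1%N < x 2%N ->
  link_slope h e (x 1%N) (x 2%N) = link_slope h e (x 1%N) (x 0%N).
Proof.
move=> [dh _] mx x01 x12; have [[sx _] _] := mx.
have s0 := sx 0%N isT; have s1 := sx 1%N isT.
apply: local_min_link_slope => //; [lra|lra|] => s ? ? ? ?.
by apply: minimal_update1 mx _ _ _ _; lra.
Qed.

(** * Splicing two minimal chains *)

Lemma steps_ncons1 (R : realType) n (a : R) (x : nat -> R) :
  0 <= x 0%N - a < pi -> steps n x -> steps n.+1 (ncons1 a x).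
Proof. by move=> ax sx [|i] //= /sx. Qed.

Lemma cost_ncons1 (R : realType) (h : R -> R) n (a : R) (x : nat -> R) :
  cost h n.+1 (ncons1 a x) = link h a (x 0%N) + cost h n x.
Proof. by rewrite costS. Qed.

Lemma splice_nested (R : realType) (h e : R -> R) p n (x y z : nat -> R) :
    sine_convex h -> tangential h e -> (0 < n)%N ->
    (forall t, h (t + 2 * pi) = h t) ->
    config p n x -> periodic_steps p n.+2 y -> is_minimal h p n.+2 y -> is_minimal h p n.+1 z ->
    y 0%N < x 0%N -> x 0%N <= y 1%N -> y 2%N < x 1%N ->
  2 * cost h n.+1 z < cost h n x + cost h n.+2 y.
Proof.
move=> hh he n0 hper [sx xn] py my mz y0x0 x0y1 y2x1; have [[sy yn] _] := my.
have y01 : y 0%N < y 1%N by lra.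
have y12 := minimal_strict hh my y01.
have x01 := sx 0%N n0; have y01' := sy 0%N isT; have y12' := sy 1%N isT.
case: n n0 => // n _ in sx xn sy yn py my mz *.
have y23' := sy 2%N isT.
(* The tails after the exchange: [y 1] followed by [x 1, x 2, ...], and [y] from [y 2] on. They have
   equally many steps, as [y] has two more than [x]. *)
have sf : steps n.+1 (ncons1 (y 1%N) (fun i => x i.+1)).
  by apply: steps_ncons1; [lra|move=> i /(sx i.+1)].
have sg : steps n.+1 (fun i => y i.+2) by move=> i /(sy i.+2).
have /= := swap_tails hh sf sg (ltW y12); rewrite xn yn.
(* The ends compare because [y 0 < x 0] and both chains advance by the same rotation. *)
case; first by lra.
move=> f' [g' [sf' sg' cfg [f0 g0 fn gn /(_ isT) f1]]].
(* The crossed tails close up: the one from [y 1] ends where [y] does, the one from [y 2] where [x]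
   does. *)
have cv : config p n.+2 (ncons1 (y 0%N) f').
  by split=> /=; [apply: steps_ncons1; rewrite ?f0|].
have cu : config p n.+2 (ncons1 (x 0%N) g').
  by split=> /=; [apply: steps_ncons1; rewrite ?g0 //; lra|rewrite gn].
have lev := mz.2 _ cv; have leu := mz.2 _ cu.
rewrite (cost_ncons1 h n (y 1%N)) in cfg.
have cuE := cost_ncons1 h n.+1 (x 0%N) g'.
have cvE := cost_ncons1 h n.+1 (y 0%N) f'.
rewrite g0 in cuE; rewrite f0 in cvE.
have cxE := costS h n x.
have cyE : cost h n.+3 y = link h (y 0%N) (y 1%N) + link h (y 1%N) (y 2%N)
    + cost h n.+1 (fun i => y i.+2) by rewrite !costS addrA.
move: cfg lev leu => /=.
rewrite cxE cyE cuE cvE => cfg lev leu.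
(* If [x 0 < y 1], the first exchange is already strict. *)
have [xy|yx] := ltP (x 0%N) (y 1%N).
  have := link_monge_lt hh xy (ltW y12) y2x1; lra.
have exy : x 0%N = y 1%N by lra.
rewrite exy in cfg leu *.
(* If [x 0 = y 1], that exchange gains nothing; it suffices that the chain starting with [y 0, y 1]
   is not minimal. *)
suff : cost h n.+2 z != link h (y 0%N) (y 1%N) + cost h n.+1 f'.
  move=> ne.
  have : cost h n.+2 z < link h (y 0%N) (y 1%N) + cost h n.+1 f'.
    by rewrite lt_neqAle ne.
  by lra.
apply/eqP => ez.
have mv : is_minimal h p n.+2 (ncons1 (y 0%N) f').
  by split=> // w /(mz.2); rewrite cvE ez.
have y23 : y 2%N < y 3%N.
  exact: (minimal_strict hh (minimal_shift 1 hper py my) y12).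
(* The chain leaves [y 1] for [x 1] or [y 3], both beyond [y 2], while the first-order condition
   gives it the same slope as [y] there. *)
have f2 : y 2%N < f' 1%N by case: f1 => /= ->; lra.
have := minimal_link_slope he mv; rewrite /= f0 => /(_ y01).
have <- := minimal_link_slope he my y01 y12.
have := sf' 0%N isT; rewrite f0 => f01 e2.
by have := link_slope_lt hh he y12 f2; rewrite e2; lra.
Qed.

Lemma periodic_unbounded (R : realType) p q (x : nat -> R) (a : R) :
  (0 < p)%N -> periodic_steps p q x -> exists i, a < x i.
Proof.
move=> p0 [_ xq].
have xk k : x (k * q)%N = x 0%N + 2 * pi * p%:R * k%:R.
  elim: k => [|k IH]; first by rewrite mul0n mulr0 addr0.
  by rewrite mulSnr xq IH -[k.+1%:R]natr1; ring.
have L0 : 0 < 2 * pi * p%:R :> R by rewrite !mulr_gt0 ?pi_gt0 ?ltr0n.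
have := archi_boundP (normr_ge0 ((a - x 0%N) / (2 * pi * p%:R))).
set k := Num.bound _ => bk; exists (k * q)%N; rewrite xk.
have := le_lt_trans (ler_norm _) bk.
by rewrite ltr_pdivrMr // mulrC; lra.
Qed.

(** If no step of [x] passes two consecutive points of [y], then [x (k + i) <= y (j + 1 + i)]
    persists for all [i]. At [i = n] this gives [x k <= y j], because [y] needs [n + 2] steps for
    the rotation that [x] makes in [n]. *)
Lemma nested_step (R : realType) p n (x y : nat -> R) : (0 < p)%N ->
    periodic_steps p n x -> periodic_steps p n.+2 y ->
  exists i j, [/\ y j < x i, x i <= y j.+1 & y j.+2 < x i.+1].
Proof.
move=> p0 px py.
(* Beyond [y 0], every point of [x] has a point of [y] before it. *)
have [k yk] := periodic_unbounded (y 0%N) p0 px.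
have first_above i : (k <= i)%N -> exists j, y j < x i /\ x i <= y j.+1.
  move=> ki.
  have ex : exists j, x i <= y j.
    by have [j /ltW ?] := periodic_unbounded (x i) p0 py; exists j.
  case: (ex_minnP ex) => [[|j] xj minj].
    by have := periodic_mono px ki; lra.
  by exists j; split=> //; rewrite ltNge; apply/negP => /minj; rewrite ltnn.
have [j [yjk kyj]] := first_above k (leqnn k).
have [|nex] := pselect (exists i, (k <= i)%N /\ x i <= y (j.+1 + (i - k))%N /\
  y (j.+2 + (i - k))%N < x i.+1).
  move=> [i [ki [xy yx]]]; have [m [ym xm]] := first_above i ki.
  exists i, m; split=> //; apply: le_lt_trans yx; apply: (periodic_mono py).
  rewrite !addSn !ltnS; rewrite leqNgt; apply/negP => lt.
  by have := periodic_mono py lt; rewrite -addSn; lra.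
have below i : x (k + i)%N <= y (j.+1 + i)%N.
  elim: i => [|i IH]; first by rewrite !addn0.
  rewrite leNgt; apply/negP => lt; apply: nex; exists (k + i)%N.
  by move: lt; rewrite addKn !addnS => lt; split; [exact: leq_addr|].
have := below n; have [_ xn] := px; have [_ yn] := py.
have : y (j.+1 + n)%N <= y (j + n.+2)%N by apply: (periodic_mono py); lia.
by rewrite xn yn; lra.
Qed.

Lemma minimal_cost_convex (R : realType) (h e : R -> R) p n (x y z : nat -> R) :
    sine_convex h -> tangential h e -> (forall t, h (t + 2 * pi) = h t) ->
    (0 < p)%N -> (0 < n)%N ->
    is_minimal h p n x -> is_minimal h p n.+2 y -> is_minimal h p n.+1 z ->
  2 * cost h n.+1 z < cost h n x + cost h n.+2 y.
Proof.
move=> hh he hper p0 n0 [cx _] [cy my] mz.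
have [x' px ex] := config_periodic n0 cx.
have [y' py ey] := config_periodic (ltn0Sn n.+1) cy.
have my' : is_minimal h p n.+2 y'.
  by split; [exact: periodic_config|move=> w /my; rewrite (eq_cost h ey)].
rewrite -(eq_cost h ex) -(eq_cost h ey).
have [i [j [yx xy yx2]]] := nested_step p0 px py.
rewrite -(cost_shift i hper px) -(cost_shift j hper py).
apply: (splice_nested hh he n0 hper _ _ _ mz) => //.
- exact/periodic_config/periodic_shift.
- exact: periodic_shift.
- exact: minimal_shift.
Qed.

(** * The support function of the curve *)

Lemma is_derive_pair (R : realType) (c : R -> R * R) (t : R) :
    derivable c t 1 ->
  is_derive t 1 (fun s => (c s).1) (derive1 c t).1 /\
  is_derive t 1 (fun s => (c s).2) (derive1 c t).2.
Proof.
rewrite derive1E => dc.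
have c1 : h^-1 *: ((c \o shift t) (h *: 1) - c t) @[h --> 0^'] --> 'D_1 c t := dc.
have c2 := cvg_comp _ _ c1 (@cvg_fst _ _ (nbhs ('D_1 c t).1) (nbhs ('D_1 c t).2) _).
have c3 := cvg_comp _ _ c1 (@cvg_snd _ _ (nbhs ('D_1 c t).1) (nbhs ('D_1 c t).2) _).
split; split.
- by apply/cvg_ex; exists ('D_1 c t).1; exact: c2.
- by apply: cvg_lim => //; exact: c2.
- by apply/cvg_ex; exists ('D_1 c t).2; exact: c3.
- by apply: cvg_lim => //; exact: c3.
Qed.

Lemma is_derive_det2 (R : realType) (c : R -> R * R) (u : R * R) (t : R) :
    derivable c t 1 ->
  is_derive t 1 (fun s => det2 u (c s)) (det2 u (derive1 c t)).
Proof.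
move=> /is_derive_pair[d1 d2].
have := is_derive1B (is_derive1M (is_derive1C u.1 t) d2)
  (is_derive1M (is_derive1C u.2 t) d1).
by rewrite !mulr0 !addr0.
Qed.

Lemma derivable1_continuous (R : realType) (f : R -> R) :
  (forall x : R, derivable f x 1) -> continuous f.
Proof. by move=> df x; apply/differentiable_continuous/derivable1_diffP. Qed.

Lemma periodic_int (R : realType) (U : Type) (f : R -> U) (T : R) (n : int) (t : R) :
  (forall t, f (t + T) = f t) -> f (t + T *~ n) = f t.
Proof.
move=> fT.
have fn (m : nat) s : f (s + T *+ m) = f s.
  elim: m => [|m IH]; first by rewrite mulr0n addr0.
  by rewrite mulrSr addrA fT.
case: n => n; first exact: fn.
by rewrite NegzE mulrNz -(fn n.+1 (t + _)) subrK.
Qed.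

Lemma translate_itv (R : realType) (T s : R) : 0 < T ->
  exists n : int, 0 <= s + T *~ n < T.
Proof.
move=> T0; exists (- Num.floor (s / T)).
have := floor_itv (s / T); set n := Num.floor _.
rewrite intrD -[T *~ _]mulrzl ler_pdivlMr // ltr_pdivrMr // rmorphN /= mulrDl mul1r.
by rewrite mulNr; lra.
Qed.

Lemma periodic_itv (R : realType) (U : Type) (f : R -> U) (T s : R) : 0 < T ->
  (forall t, f (t + T) = f t) -> exists2 t, 0 <= t < T & f t = f s.
Proof.
move=> T0 fT; have [n nT] := translate_itv s T0.
by exists (s + T *~ n) => //; exact: periodic_int.
Qed.

Lemma is_derive_min0 (R : realType) (f : R -> R) (t d : R) :
  (forall x : R, derivable f x 1) -> (forall s, f t <= f s) ->
  is_derive t 1 f d -> d = 0.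
Proof.
move=> df ft [_ <-].
have : is_derive t 1 f 0.
  apply: (@derive1_at_min R f (t - 1) (t + 1)) => //; first by lra.
  by rewrite in_itv /=; lra.
by move=> [_ ->].
Qed.

(** A minimum of [det2 (dir theta) (c s)] over a period has velocity parallel to [dir theta]. The
    velocity has the same sense because the curve lies to the left of both. *)
Lemma tangency_exists (R : realType) (c : R -> R * R) (T theta : R) :
    smooth_strictly_convex_closed c T ->
  exists t r, [/\ gamma c theta = c t, 0 < r, derive1 c t = r *: dir theta &
    forall s, 0 <= det2 (dir theta) (c s - c t)].
Proof.
move=> [T0 cT csimple csmooth creg cconv].
have dF s := is_derive_det2 (dir theta) (csmooth 0%N s).
have dF' s : derivable (fun s => det2 (dir theta) (c s)) s 1 by case: (dF s).
have [t _ tmin] := @EVT_min R (fun s => det2 (dir theta) (c s)) _ _ (ltW T0)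
  (continuous_subspaceT (derivable1_continuous dF')).
have gmin s : det2 (dir theta) (c t) <= det2 (dir theta) (c s).
  have [|s' s'T <-] := @periodic_itv R _ (fun s => det2 (dir theta) (c s)) T s T0.
    by move=> u; rewrite cT.
  by apply: tmin; rewrite in_itv /=; lra.
have d0 := is_derive_min0 dF' gmin (dF t).
have pos s : 0 <= det2 (dir theta) (c s - c t).
  by have := gmin s; rewrite /det2 /=; lra.
set r := (derive1 c t).1 * cos theta + (derive1 c t).2 * sin theta.
have cr : derive1 c t = r *: dir theta.
  move: d0; rewrite /r /det2 /dir /=; case: (derive1 c t) => u v /= uv.
  have cs := cos2Dsin2 theta.
  congr (_, _); rewrite /= /GRing.scale /=.
    have -> : (u * cos theta + v * sin theta) * cos theta =
      u * (cos theta ^+ 2 + sin theta ^+ 2)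
      + sin theta * (cos theta * v - sin theta * u) by ring.
    by rewrite uv cs; ring.
  have -> : (u * cos theta + v * sin theta) * sin theta =
      v * (cos theta ^+ 2 + sin theta ^+ 2)
      - cos theta * (cos theta * v - sin theta * u) by ring.
  by rewrite uv cs; ring.
have r0 : 0 < r.
  (* A constant curve would not be injective on [[0, T)]. *)
  have [s cst] : exists s, c s <> c t.
    apply: contrapT => /forallNP H.
    have E s : c s = c t by apply: contrapT; exact: H.
    have := csimple 0 (T / 2); rewrite !E.
    by move=> /(_ _ _ erefl); lra.
  have := cconv s t cst; rewrite cr; have := pos s.
  rewrite /det2 /= /GRing.scale /=.
  set X := (X in 0 <= X -> _) => X0.
  have -> : r * cos theta * ((c s).2 - (c t).2) - r * sin theta * ((c s).1 - (c t).1) = r * X.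
    by rewrite /X; ring.
  move=> rX; rewrite -(pmulr_lgt0 _ (_ : 0 < X)) // lt_neqAle X0 andbT.
  by apply/eqP => X1; move: rX; rewrite -X1 mulr0 ltxx.
have tang : tangency_points c theta (c t) by exists t; split=> //; exists r.
exists t, r; split=> //.
rewrite /gamma; apply: xget_unique => // P [t' [-> [r' [r'0 cr']]]].
(* Two points with the same tangent direction would each lie strictly to the left of the tangent at
   the other. *)
apply: contrapT => ne.
have := cconv _ _ (not_eq_sym ne); rewrite cr'; have := cconv _ _ ne; rewrite cr.
rewrite /det2 /= /GRing.scale /=.
rewrite -!mulrA -!mulrBr !pmulr_rgt0 //; lra.
Qed.

(* The outward normal at [gamma c a] is [(sin a, - cos a)]. *)
Definition supp (R : realType) (c : R -> R * R) (a : R) : R :=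
  - det2 (dir a) (gamma c a).

(** The coordinate of the tangency point on its tangent, from the same origin as [side]. *)
Definition dsupp (R : realType) (c : R -> R * R) (a : R) : R :=
  cos a * (gamma c a).1 + sin a * (gamma c a).2.

Lemma scc_derivable (R : realType) (c : R -> R * R) (T : R) :
  smooth_strictly_convex_closed c T -> forall t, derivable c t 1.
Proof. by move=> [_ _ _ csmooth _ _] t; exact: (csmooth 0%N t). Qed.

Lemma supp_ge (R : realType) (c : R -> R * R) (T a b : R) :
    smooth_strictly_convex_closed c T ->
  - det2 (dir b) (gamma c a) <= supp c b.
Proof.
move=> hc; rewrite /supp.
have [t [_ [-> _ _ _]]] := tangency_exists a hc.
have [t' [_ [-> _ _ /(_ t)]]] := tangency_exists b hc.
by rewrite /det2 /=; lra.
Qed.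

(** In case of equality [gamma c a] would also minimize [det2 (dir b)] on the curve, so its velocity
    would be parallel to [dir b]. *)
Lemma supp_gt (R : realType) (c : R -> R * R) (T a b : R) :
    smooth_strictly_convex_closed c T -> sin (a - b) != 0 ->
  - det2 (dir b) (gamma c a) < supp c b.
Proof.
move=> hc sab; rewrite lt_neqAle (supp_ge _ _ hc) andbT; apply/eqP; rewrite /supp.
have [t [r [-> r0 cr _]]] := tangency_exists a hc.
have [t' [_ [-> _ _ tmin]]] := tangency_exists b hc.
move=> /oppr_inj E.
have dF s := is_derive_det2 (dir b) (@scc_derivable _ _ _ hc s).
have := is_derive_min0 _ _ (dF t).
rewrite /= cr => /(_ _ _) d0.
have : det2 (dir b) (r *: dir a) = 0.
  apply: d0 => [x|s]; first by case: (dF x).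
  by rewrite E; have := tmin s; rewrite /det2 /=; lra.
rewrite /det2 /= /GRing.scale /= => /eqP.
rewrite (_ : _ - _ = r * sin (a - b)); last by rewrite sinB; ring.
by rewrite mulf_eq0 (negPf sab) gt_eqF.
Qed.

(** This expands [gamma c a] in the frame of its own tangent and normal. As a function of [b] it is
    the support function of that single point. *)
Lemma det2_gammaE (R : realType) (c : R -> R * R) (a b : R) :
  - det2 (dir b) (gamma c a) = supp c a * cos (b - a) + dsupp c a * sin (b - a).
Proof.
have cs := cos2Dsin2 a; rewrite /supp /dsupp /det2 /dir /= sinB cosB.
move: (gamma c a) => [u v] /=.
have -> : sin b * u = (cos a ^+ 2 + sin a ^+ 2) * (sin b * u) by rewrite cs mul1r.
have -> : cos b * v = (cos a ^+ 2 + sin a ^+ 2) * (cos b * v) by rewrite cs mul1r.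
by ring.
Qed.

Lemma supp_tangent_lt (R : realType) (c : R -> R * R) (T a b : R) :
    smooth_strictly_convex_closed c T -> sin (b - a) != 0 ->
  supp c a * cos (b - a) + dsupp c a * sin (b - a) < supp c b.
Proof.
move=> hc sab; rewrite -det2_gammaE; apply: (supp_gt hc).
by rewrite -opprB sinN oppr_eq0.
Qed.

(** Weight the tangent inequalities from [m] to [b] and from [m] to [a] by [sin (m - a)] and
    [sin (b - m)]: in the sum the terms in [dsupp] cancel. *)
Lemma supp_sine_convex (R : realType) (c : R -> R * R) (T : R) :
  smooth_strictly_convex_closed c T -> sine_convex (supp c).
Proof.
move=> hc a m b am mb bapi; rewrite /sine_gap.
have s1 : 0 < sin (b - m) by apply: sinB_gt0; lra.
have s2 : 0 < sin (m - a) by apply: sinB_gt0; lra.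
have Hb : supp c m * cos (b - m) + dsupp c m * sin (b - m) < supp c b.
  by apply: (supp_tangent_lt hc); rewrite gt_eqF.
have Ha : supp c m * cos (a - m) + dsupp c m * sin (a - m) < supp c a.
  by apply: (supp_tangent_lt hc); rewrite -opprB sinN oppr_eq0 gt_eqF.
move: Ha; rewrite -(opprB m a) cosN sinN => Ha.
have -> : b - a = (m - a) + (b - m) by lra.
rewrite (sinD (m - a)).
rewrite -(ltr_pM2r s1) in Ha; rewrite -(ltr_pM2r s2) in Hb.
by lra.
Qed.

Lemma supp_periodic (R : realType) (c : R -> R * R) (a : R) :
  supp c (a + 2 * pi) = supp c a.
Proof.
have -> : 2 * pi = pi *+ 2 :> R by rewrite mulr_natl.
have dirE : dir (a + pi *+ 2) = dir a by rewrite /dir cosD2pi sinD2pi.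
rewrite /supp dirE; congr (- det2 _ _); rewrite /gamma; congr xget.
by rewrite /tangency_points dirE.
Qed.

(** The point [gamma c (a + pi / 2)] is strictly to the left of one of the two parallel tangents and
    not to the right of the other. *)
Lemma supp_width (R : realType) (c : R -> R * R) (T a : R) :
    smooth_strictly_convex_closed c T -> 0 < supp c a + supp c (a + pi).
Proof.
move=> hc.
have h1 := supp_gt (a := a + pi / 2) (b := a) hc.
have h2 := supp_ge (a + pi / 2) (a + pi) hc.
have : - det2 (dir a) (gamma c (a + pi / 2)) < supp c a.
  by apply: h1; rewrite addrC addKr sin_pihalf oner_eq0.
by move: h2; rewrite /det2 /dir /= sinDpi cosDpi; lra.
Qed.

Lemma gamma_bounded (R : realType) (c : R -> R * R) (T : R) :
    smooth_strictly_convex_closed c T ->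
  exists2 B : R, 0 <= B & forall a, (gamma c a).1 ^+ 2 + (gamma c a).2 ^+ 2 <= B.
Proof.
move=> hc; have [T0 cT _ _ _ _] := hc.
have d t := is_derive_pair (@scc_derivable _ _ _ hc t).
have cN : continuous (fun s => (c s).1 * (c s).1 + (c s).2 * (c s).2).
  apply: derivable1_continuous => t; have [d1 d2] := d t.
  by case: (is_derive1D (is_derive1M d1 d1) (is_derive1M d2 d2)).
have [t _ tmax] := @EVT_max R _ _ _ (ltW T0) (continuous_subspaceT cN).
exists ((c t).1 * (c t).1 + (c t).2 * (c t).2).
  by rewrite -!expr2 addr_ge0 ?sqr_ge0.
move=> a; have [s [_ [-> _ _ _]]] := tangency_exists a hc.
have [s' s'T <-] := periodic_itv s T0 cT.
by rewrite !expr2; apply: tmax; rewrite in_itv /=; lra.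
Qed.

Lemma det2_sqr_le (R : realType) (u v : R * R) :
  det2 u v ^+ 2 <= (u.1 ^+ 2 + u.2 ^+ 2) * (v.1 ^+ 2 + v.2 ^+ 2).
Proof.
rewrite -subr_ge0 /det2.
rewrite (_ : _ - _ = (u.1 * v.1 + u.2 * v.2) ^+ 2) ?sqr_ge0 //; ring.
Qed.

(** For the chord bound, test both directions with the tangency point of the larger value: the
    difference is at most the norm of that point times the chord [dir b - dir a]. *)
Lemma supp_bounded (R : realType) (c : R -> R * R) (T : R) :
    smooth_strictly_convex_closed c T ->
  exists B : R, [/\ 0 <= B, forall a, supp c a ^+ 2 <= B &
    forall a b, (supp c b - supp c a) ^+ 2 <= 2 * B * (1 - cos (b - a))].
Proof.
move=> hc; have [B B0 hB] := gamma_bounded hc; exists B.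
have dirB a b : (dir b - dir a).1 ^+ 2 + (dir b - dir a).2 ^+ 2 = 2 * (1 - cos (b - a)).
  rewrite cosB /=; have := cos2Dsin2 a; have := cos2Dsin2 b; lra.
have le1 a b : supp c a <= supp c b ->
    (supp c b - supp c a) ^+ 2 <= 2 * B * (1 - cos (b - a)).
  move=> ab; have := supp_ge b a hc.
  have := det2_sqr_le (dir b - dir a) (gamma c b); rewrite dirB => h1 h2.
  have h3 : supp c b - supp c a <= - det2 (dir b - dir a) (gamma c b).
    by move: h2; rewrite /supp /det2 /=; lra.
  apply: (@le_trans _ _ (det2 (dir b - dir a) (gamma c b) ^+ 2)).
    by rewrite -[leRHS]sqrrN; apply: lerXn2r => //; rewrite nnegrE; lra.
  apply: (le_trans h1); rewrite -subr_ge0.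
  rewrite (_ : _ - _ = 2 * (1 - cos (b - a)) *
    (B - ((gamma c b).1 ^+ 2 + (gamma c b).2 ^+ 2))); last by ring.
  by rewrite !mulr_ge0 ?subr_ge0 ?cos_le1.
split=> // [a|a b].
  rewrite /supp sqrrN; apply: le_trans (det2_sqr_le _ _) _.
  by rewrite cos2Dsin2 mul1r.
case: (leP (supp c a) (supp c b)) => [|/ltW]; first exact: le1.
by move=> /le1; rewrite -(opprB a b) cosN -sqrrN opprB.
Qed.

(** * Differentiability of the support function *)

Lemma sin_cos_lipschitz (R : realType) (a b : R) :
  `|sin a - sin b| <= `|a - b| /\ `|cos a - cos b| <= `|a - b|.
Proof.
have mvt (f df : R -> R) : (forall x : R, is_derive x 1 f (df x)) -> (forall x, `|df x| <= 1) ->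
    forall x y : R, `|f x - f y| <= `|x - y|.
  move=> fd df1.
  have le x y : x <= y -> `|f y - f x| <= `|y - x|.
    move=> xy; have fc : continuous f.
      by apply: derivable1_continuous => z; case: (fd z).
    have [z _ ->] := MVT_segment xy (fun z _ => fd z) (continuous_subspaceT fc).
    by rewrite normrM ler_piMl.
  move=> x y; case: (leP x y) => [|/ltW] /le //.
  by rewrite distrC (distrC x).
split; first exact: (mvt _ _ (@is_derive_sin R) (@cos_max R)).
by apply: (mvt _ _ (@is_derive_cos R)) => x; rewrite normrN sin_max.
Qed.

(* The auxiliary function is positive on a whole period, hence bounded below by
   some [mu > 0]; where the determinant is below [mu], the positive part is
   nonzero. *)
Lemma near_tangent_near_point (R : realType) (c : R -> R * R) (T a eps : R) :
    smooth_strictly_convex_closed c T -> 0 < eps ->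
  exists2 mu : R, 0 < mu & forall b, det2 (dir a) (gamma c b - gamma c a) < mu ->
    `|(gamma c b).1 - (gamma c a).1| < eps /\ `|(gamma c b).2 - (gamma c a).2| < eps.
Proof.
move=> hc eps0; have [T0 cT _ _ _ cconv] := hc.
have [t [r [ga r0 cr pos]]] := tangency_exists a hc.
have spos s : c s <> c t -> 0 < det2 (dir a) (c s - c t).
  move=> ne; rewrite lt_neqAle pos andbT eq_sym; apply/eqP => d0.
  have := cconv _ _ ne; rewrite cr /det2 /= /GRing.scale /= -!mulrA -mulrBr.
  by move: d0; rewrite /det2 /= => ->; rewrite mulr0 ltxx.
pose dist2 s := ((c s).1 - (c t).1) * ((c s).1 - (c t).1) +
                ((c s).2 - (c t).2) * ((c s).2 - (c t).2).
pose F s := det2 (dir a) (c s) - det2 (dir a) (c t) + Num.max 0 (eps ^+ 2 - dist2 s).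
have d s := is_derive_pair (@scc_derivable _ _ _ hc s).
have cd2 : continuous dist2.
  apply: derivable1_continuous => s; have [d1 d2] := d s.
  have d1' := is_derive1B d1 (is_derive1C (c t).1 s).
  have d2' := is_derive1B d2 (is_derive1C (c t).2 s).
  by case: (is_derive1D (is_derive1M d1' d1') (is_derive1M d2' d2')).
have cdet : continuous (fun s => det2 (dir a) (c s)).
  apply: derivable1_continuous => s.
  by case: (is_derive_det2 (dir a) (@scc_derivable _ _ _ hc s)).
have cF : continuous F.
  move=> s; apply: cvgD.
    by apply: cvgB; [exact: cdet|exact: cvg_cst].
  apply: (@continuous_max _ _ (cst 0) (fun s => eps ^+ 2 - dist2 s)).
    exact: cvg_cst.
  by apply: cvgB; [exact: cvg_cst|exact: cd2].
have FE s : F s = det2 (dir a) (c s - c t) + Num.max 0 (eps ^+ 2 - dist2 s).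
  by rewrite /F /det2 /=; lra.
have Fpos s : 0 < F s.
  rewrite FE; case: (pselect (c s = c t)) => [E|/spos ?].
    rewrite ltr_wpDl ?pos // lt_max /dist2 E !subrr mulr0 addr0 subr0.
    by rewrite exprn_gt0 ?orbT.
  by rewrite ltr_pwDl // le_max lexx.
have [s0 _ smin] := @EVT_min R F _ _ (ltW T0) (continuous_subspaceT cF).
exists (F s0) => // b.
have [s [_ [-> _ _ _]]] := tangency_exists b hc; rewrite ga.
have [s' s'T <-] := periodic_itv s T0 cT.
have h1 : F s0 <= F s' by apply: smin; rewrite in_itv /=; lra.
rewrite [F s']FE in h1; move=> h2.
have {}h1 : 0 < eps ^+ 2 - dist2 s'.
  rewrite ltNge; apply/negP => h3; move: h1; rewrite (max_idPl h3).
  by lra.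
move: h1; rewrite /dist2.
move: (_.1 - _.1) (_.2 - _.2) => u v h1.
by split; rewrite -(ltr_pXn2r (ltn0Sn 1)) ?nnegrE ?(ltW eps0) // real_normK ?num_real //;
  have := sqr_ge0 u; have := sqr_ge0 v; rewrite !expr2; move: h1; rewrite !expr2; lra.
Qed.

(* The remainder of [supp] at [a] is at most the rotation of the tangent
   direction times the displacement of the tangency point, which tends to 0. *)
Lemma supp_remainder (R : realType) (c : R -> R * R) (T a b : R) :
    smooth_strictly_convex_closed c T ->
  let k := supp c b - (supp c a * cos (b - a) + dsupp c a * sin (b - a)) in
  0 <= k /\ k <= `|b - a| * (`|(gamma c b).1 - (gamma c a).1| +
                              `|(gamma c b).2 - (gamma c a).2|).
Proof.
move=> hc /=; rewrite -det2_gammaE.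
have h1 := supp_ge a b hc; have h2 := supp_ge b a hc.
split; first by lra.
have [sl cl] := sin_cos_lipschitz b a.
move: h1 h2; rewrite /supp /det2 /dir /=.
move: (gamma c a) (gamma c b) => [u v] [u' v'] /= h1 h2.
have h3 : (sin b - sin a) * (u' - u) <= `|b - a| * `|u' - u|.
  by apply: (le_trans (ler_norm _)); rewrite normrM ler_wpM2r.
have h4 : - (cos b - cos a) * (v' - v) <= `|b - a| * `|v' - v|.
  by apply: (le_trans (ler_norm _)); rewrite normrM normrN ler_wpM2r.
by lra.
Qed.

(** Compare with the support function [g] of the point [gamma c a]. By [supp_remainder] the error is
    [o(b - a)], because the tangency point depends continuously on the direction. *)
Lemma is_derive_supp (R : realType) (c : R -> R * R) (T a : R) :
  smooth_strictly_convex_closed c T -> is_derive a 1 (supp c) (dsupp c a).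
Proof.
move=> hc.
pose g b := supp c a * cos (b - a) + dsupp c a * sin (b - a).
have dg : is_derive a 1 g (dsupp c a).
  have dB : is_derive a 1 (fun s : R => s - a) (1 - 0).
    exact: is_derive1B (is_derive_id _ _) (is_derive1C _ _).
  have dC := @is_derive1_comp R cos (fun s => s - a) a _ _ (is_derive_cos _) dB.
  have dS := @is_derive1_comp R sin (fun s => s - a) a _ _ (is_derive_sin _) dB.
  apply: (is_derive_eq (is_derive1D (is_derive1M (is_derive1C (supp c a) a) dC)
    (is_derive1M (is_derive1C (dsupp c a) a) dS))).
  by rewrite /= subrr sin0 cos0; ring.
pose k b := supp c b - g b.
have k0 : k a = 0 by rewrite /k /g subrr sin0 cos0; lra.
have dk : is_derive a 1 k 0.
  (* At [b = a] the quotient is [0 / 0 = 0], the required derivative. *)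
  apply/is_derive1_caratheodory; exists (fun b => k b / (b - a)); split.
  - move=> b; rewrite k0 subr0; have [->|ba] := eqVneq b a.
      by rewrite k0 subrr mulr0.
    by rewrite divfK // subr_eq0.
  - rewrite /prop_for /continuous_at k0 mul0r; apply/cvgrPdist_lt => eps eps0.
    have eps2 : 0 < eps / 2 by lra.
    have [mu mu0 hmu] := near_tangent_near_point a hc eps2.
    have [B B0 hB] := gamma_bounded hc.
    have normB b : `|(gamma c b).1| <= B + 1 /\ `|(gamma c b).2| <= B + 1.
      have := hB b; have := sqr_ge0 (gamma c b).1; have := sqr_ge0 (gamma c b).2.
      move: (gamma c b) => [u v] /= v0 u0 uvB.
      split; rewrite -(ler_pXn2r (ltn0Sn 1)) ?nnegrE ?real_normK ?num_real //;
      by rewrite ?sqrrD ?expr1n ?mulr1; have := sqr_ge0 B; lra.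
    near=> b.
    (* The coordinates of the tangency points are bounded by [B + 1], so each of the two terms of
       the determinant is at most [2 * (B + 1)] times the angle. *)
    have ba : `|b - a| < mu / (4 * (B + 1)).
      rewrite distrC; near: b; apply: (@cvgr_dist_lt _ _ _ _ _ id a) => //.
      by rewrite divr_gt0 // mulr_gt0; lra.
    rewrite ltr_pdivlMr in ba; last by rewrite mulr_gt0; lra.
    have [d1 d2] : `|(gamma c b).1 - (gamma c a).1| < eps / 2 /\
        `|(gamma c b).2 - (gamma c a).2| < eps / 2.
      apply: hmu.
      have [sl cl] := sin_cos_lipschitz b a.
      have [n1 n2] := normB a; have [n3 n4] := normB b.
      have := supp_ge a b hc; rewrite /supp /det2 /dir /= => h1.
      apply: le_lt_trans ba.
      have h3 : (sin b - sin a) * ((gamma c b).1 - (gamma c a).1) <= `|b - a| * (2 * (B + 1)).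
        apply: (le_trans (ler_norm _)); rewrite normrM ler_pM //.
        by apply: (le_trans (ler_normB _ _)); lra.
      have h4 : - (cos b - cos a) * ((gamma c b).2 - (gamma c a).2) <= `|b - a| * (2 * (B + 1)).
        apply: (le_trans (ler_norm _)); rewrite normrM normrN ler_pM //.
        by apply: (le_trans (ler_normB _ _)); lra.
      by move: h1 h3 h4; set X := `|b - a|; lra.
    rewrite sub0r normrN normrM.
    have [->|bna] := eqVneq b a; first by rewrite k0 normr0 mul0r.
    rewrite normfV ltr_pdivrMr ?normr_gt0 ?subr_eq0 //.
    have [k1 k2] := supp_remainder a b hc.
    rewrite ger0_norm //; apply: (le_lt_trans k2); rewrite mulrC ltr_pM2r; first by lra.
    by rewrite normr_gt0 subr_eq0.
  - by rewrite k0 mul0r.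
have := is_derive1D dk dg; rewrite add0r.
by congr (is_derive _ _ _ _); apply/funext => b; rewrite /k subrK.
Unshelve. all: by end_near.
Qed.

(** * Existence of minimal chains *)

(** Here [2 * (1 - cos (b - a))] is the squared chord between the directions, of the order of
    [sin (b - a) ^+ 2] near the diagonal. *)
Definition chord_bounded (R : realType) (B : R) (h : R -> R) : Prop :=
  [/\ 0 <= B, forall a, h a ^+ 2 <= B &
      forall a b, (h b - h a) ^+ 2 <= 2 * B * (1 - cos (b - a))].

(** The numerator is [(h a ^+ 2 + h b ^+ 2) * (1 - cos (b - a))] minus the square of [h b - h a].
    Both terms lie between 0 and [2 * B * (1 - cos (b - a))], and [1 - c <= s ^+ 2] for [c >= 0]. *)
Lemma link_small (R : realType) (h : R -> R) (B a b : R) : chord_bounded B h ->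
    0 <= b - a < pi -> 0 <= cos (b - a) ->
  `|link h a b| <= B * sin (b - a).
Proof.
move=> [B0 hB hL] /andP[ab bapi] c0; move: ab; rewrite le_eqVlt => /orP[/eqP ab|ab].
  have -> : b = a by lra.
  by rewrite link_diag normr0 subrr sin0 mulr0.
have s0 : 0 < sin (b - a) by apply: sin_gt0_pi; rewrite ab.
have := hL a b; have ha := hB a; have hb := hB b.
have := cos2Dsin2 (b - a); have := cos_le1 (b - a); have := sqr_ge0 (h b - h a).
have := sqr_ge0 (h a); have := sqr_ge0 (h b).
rewrite /link normrM normfV [`|2 * _|]gtr0_norm ?mulr_gt0 // ler_pdivrMr ?mulr_gt0 //.
move: c0 s0 ha hb; move: (cos _) (sin _) (h a) (h b) => c s x y c0 s0 ha hb y0 x0 d0 c1 cs hd.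
have k1 : B * (1 - c) <= B * s ^+ 2.
  rewrite ler_wpM2l // -subr_ge0.
  rewrite (_ : _ - _ = c * (1 - c)) ?mulr_ge0 ?subr_ge0 //.
  by rewrite -(addrK (c ^+ 2) (s ^+ 2)) (addrC (s ^+ 2)) cs; ring.
have k2 : (x ^+ 2 + y ^+ 2) * (1 - c) <= 2 * B * (1 - c).
  by rewrite ler_wpM2r ?subr_ge0 //; lra.
have k3 : 0 <= (x ^+ 2 + y ^+ 2) * (1 - c) by rewrite mulr_ge0 ?subr_ge0 //; lra.
have -> : 2 * x * y - (x ^+ 2 + y ^+ 2) * c =
  (x ^+ 2 + y ^+ 2) * (1 - c) - (y - x) ^+ 2 by ring.
by rewrite ler_norml; apply/andP; split; lra.
Qed.

(** Now the numerator is [(h a + h b) ^+ 2] minus [(h a ^+ 2 + h b ^+ 2) * (1 + cos (b - a))], and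
    [1 + c <= s ^+ 2] for [c <= 0]. *)
Lemma link_wide_ge (R : realType) (h : R -> R) (B a b : R) : chord_bounded B h ->
    0 < b - a < pi -> cos (b - a) <= 0 ->
  (h a + h b) ^+ 2 / (2 * sin (b - a)) - B * sin (b - a) <= link h a b.
Proof.
move=> [B0 hB hL] bapi c0; have s0 := sin_gt0_pi bapi.
have ha := hB a; have hb := hB b.
have := cos2Dsin2 (b - a); have := cos_geN1 (b - a).
have := sqr_ge0 (h a); have := sqr_ge0 (h b).
rewrite lerBlDr /link -lerBlDl -mulrBl ler_pdivrMr ?mulr_gt0 //.
move: c0 s0 ha hb; move: (cos _) (sin _) (h a) (h b) => c s x y c0 s0 ha hb y0 x0 c1 cs.
have k1 : B * (1 + c) <= B * s ^+ 2.
  rewrite ler_wpM2l // -subr_ge0 (_ : _ - _ = (- c) * (1 + c)) ?mulr_ge0 //; [lra|lra|].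
  by rewrite -(addrK (c ^+ 2) (s ^+ 2)) (addrC (s ^+ 2)) cs; ring.
have k2 : (x ^+ 2 + y ^+ 2) * (1 + c) <= 2 * B * (1 + c).
  by rewrite ler_wpM2r //; lra.
have -> : (x + y) ^+ 2 - (2 * x * y - (x ^+ 2 + y ^+ 2) * c) =
  (x ^+ 2 + y ^+ 2) * (1 + c) by ring.
by lra.
Qed.

Lemma link_ge (R : realType) (h : R -> R) (B a b : R) : chord_bounded B h ->
  0 <= b - a < pi -> - B <= link h a b.
Proof.
move=> hB bapi; have [B0 _ _] := hB.
have s1 := sin_le1 (b - a).
have Bs : B * sin (b - a) <= B by rewrite ler_piMr.
case: (leP 0 (cos (b - a))) => [c0|/ltW c0].
  by have := link_small hB bapi c0; rewrite ler_norml => /andP[]; lra.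
have bapi' : 0 < b - a < pi.
  case/andP: bapi => ab ->; rewrite andbT lt_neqAle ab andbT; apply/eqP => E.
  by move: c0; rewrite -E cos0; lra.
apply: le_trans (link_wide_ge hB bapi' c0).
have : 0 <= (h a + h b) ^+ 2 / (2 * sin (b - a)).
  by rewrite divr_ge0 ?sqr_ge0 // mulr_ge0 // ltW // sin_gt0_pi.
by lra.
Qed.

Lemma sin_le_id (R : realType) (x : R) : 0 <= x -> sin x <= x.
Proof.
move=> x0; have [] := sin_cos_lipschitz x 0; rewrite sin0 !subr0 (ger0_norm x0) => h _.
exact: le_trans (ler_norm _) h.
Qed.

(** When [b] is close to [a + pi], the sum [h a + h b] is close to a width of the curve, so the main
    term of [link_wide_ge] explodes. *)
Lemma link_blowup (R : realType) (h : R -> R) (B W M : R) : chord_bounded B h ->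
    0 < W -> (forall a, W <= h a + h (a + pi)) ->
  exists2 eta : R, 0 < eta <= 1 & forall a b, pi - eta < b - a < pi -> M < link h a b.
Proof.
move=> hB W0 hW; have [B0 _ hL] := hB.
have M0 : 0 <= `|M| := normr_ge0 M.
have MM : M <= `|M| := ler_norm M.
have D0 : 0 < 8 * (`|M| + B + 1) by lra.
have W2 : 0 < W ^+ 2 by rewrite exprn_gt0.
(* The bound on [eta] gives both [2 * B * eta <= (W / 2) ^+ 2], whence [h a + h b >= W / 2], and
   [(W / 2) ^+ 2 / (2 * eta) >= |M| + B + 1]. *)
exists (Num.min 1 (W ^+ 2 / (8 * (`|M| + B + 1)))).
  by rewrite lt_min ge_min lexx /= ltr01 divr_gt0.
set eta := Num.min _ _ => a b bapi.
have eta1 : eta <= 1 by rewrite /eta ge_min lexx.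
have eta2 : eta * (8 * (`|M| + B + 1)) <= W ^+ 2.
  by rewrite -ler_pdivlMr // /eta ge_min lexx orbT.
have pi2 := pihalf_ge1 R.
have bapi' : 0 < b - a < pi by lra.
set d := pi - (b - a).
have d0 : 0 < d < eta by rewrite /d; lra.
have sE : sin (b - a) = sin d by rewrite /d (sinB pi) sinpi cospi; ring.
have cE : cos (b - a) = - cos d by rewrite /d (cosB pi) sinpi cospi; ring.
have c0 : 0 <= cos d by apply: cos_ge0_pihalf; lra.
have s0 : 0 < sin d by rewrite -sE sin_gt0_pi.
have sd : sin d <= d by apply: sin_le_id; lra.
have c1 : cos (b - a) <= 0 by lra.
apply: lt_le_trans (link_wide_ge hB bapi' c1); rewrite sE.
have Hd : (h (a + pi) - h b) ^+ 2 <= (W / 2) ^+ 2.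
  apply: le_trans (hL b (a + pi)) _.
  have -> : a + pi - b = d by rewrite /d; ring.
  have k1 : 1 - cos d <= sin d ^+ 2.
    rewrite sin2cos2 -subr_ge0 (_ : _ - _ = cos d * (1 - cos d)); last by ring.
    by rewrite mulr_ge0 // subr_ge0 cos_le1.
  have k2 : sin d ^+ 2 <= eta.
    rewrite expr2; apply: (@le_trans _ _ (sin d * 1)); last by lra.
    by rewrite ler_wpM2l //; lra.
  have k3 : B * (1 - cos d) <= B * eta by rewrite ler_wpM2l //; lra.
  have k4 : 0 <= eta * (`|M| + 1) by rewrite mulr_ge0 //; lra.
  by rewrite exprMn; lra.
have Hab : W / 2 <= h a + h b.
  have : h (a + pi) - h b <= W / 2.
    apply: le_trans (ler_norm _) _; rewrite -(ler_pXn2r (ltn0Sn 1)) ?nnegrE ?real_normK ?num_real //.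
    lra.
  by have := hW a; lra.
have k5 : (W / 2) ^+ 2 <= (h a + h b) ^+ 2 by rewrite lerXn2r ?nnegrE //; lra.
have k6 : `|M| + B + 1 <= (h a + h b) ^+ 2 / (2 * sin d).
  rewrite ler_pdivlMr ?mulr_gt0 //; apply: le_trans k5.
  have : (`|M| + B + 1) * (2 * sin d) <= (`|M| + B + 1) * (2 * eta).
    by rewrite ler_wpM2l //; lra.
  by rewrite exprMn; lra.
have k7 : B * sin d <= B by rewrite ler_piMr // sin_le1.
by lra.
Qed.

Lemma width_bound (R : realType) (h : R -> R) : continuous h ->
    (forall t, h (t + 2 * pi) = h t) -> (forall a, 0 < h a + h (a + pi)) ->
  exists2 W : R, 0 < W & forall a, W <= h a + h (a + pi).
Proof.
move=> hc hper hW.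
have pi0 : 0 < 2 * pi :> R by rewrite mulr_gt0 ?pi_gt0.
have cW : continuous (fun a => h a + h (a + pi)).
  move=> a; apply: cvgD; first exact: hc.
  apply: (@continuous_comp _ _ _ (fun a => a + pi) h); last exact: hc.
  by apply: cvgD; [exact: cvg_id|exact: cvg_cst].
have [w _ wmin] := @EVT_min R _ _ _ (ltW pi0) (continuous_subspaceT cW).
exists (h w + h (w + pi)) => // a.
have [|a' a'E <-] := @periodic_itv R _ (fun a => h a + h (a + pi)) _ a pi0.
  by move=> t; rewrite hper addrAC hper.
by apply: wmin; rewrite in_itv /=; lra.
Qed.

(** Off the diagonal this is continuity of a quotient. On it, [link_small] squeezes the value to 0,
    which requires nonnegative steps and so the restriction to [K]. *)
Lemma cvg_link_within (R : realType) (h : R -> R) (B : R) (T : topologicalType)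
    (K : set T) (f g : T -> R) (v : T) :
    continuous h -> chord_bounded B h -> continuous f -> continuous g ->
    (forall w, K w -> 0 <= g w - f w < pi) -> K v ->
  link h (f w) (g w) @[w --> within K (nbhs v)] --> link h (f v) (g v).
Proof.
move=> hc hB fc gc fg Kv; have [B0 _ _] := hB.
have dc : g w - f w @[w --> v] --> g v - f v by apply: cvgB; [exact: gc|exact: fc].
have sc : sin (g w - f w) @[w --> v] --> sin (g v - f v).
  apply: continuous_cvg dc; exact: continuous_sin.
have cc : cos (g w - f w) @[w --> v] --> cos (g v - f v).
  apply: continuous_cvg dc; exact: continuous_cos.
have hf : h (f w) @[w --> v] --> h (f v) by apply: continuous_cvg (fc v); exact: hc.
have hg : h (g w) @[w --> v] --> h (g v) by apply: continuous_cvg (gc v); exact: hc.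
have [fgv|fgv] := eqVneq (f v) (g v); last first.
  have s0 : 0 < sin (g v - f v).
    apply: sin_gt0_pi; have /andP[fv ->] := fg v Kv; rewrite andbT lt_neqAle fv andbT.
    by rewrite eq_sym subr_eq0 eq_sym.
  apply: cvg_within_filter; rewrite /link; apply: cvgM.
    apply: cvgB; first by apply: cvgM => //; apply: cvgM => //; exact: cvg_cst.
    apply: cvgM => //; apply: cvgD; rewrite !expr2; under eq_fun do rewrite expr2; exact: cvgM.
  apply: cvgV; first by rewrite mulf_neq0 // gt_eqF.
  by apply: cvgM => //; exact: cvg_cst.
rewrite fgv link_diag; rewrite fgv subrr sin0 in sc; rewrite fgv subrr cos0 in cc.
have up : B * sin (g w - f w) @[w --> within K (nbhs v)] --> (0 : R).
  apply: cvg_within_filter; 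
  have : B * sin (g w - f w) @[w --> v] --> B * 0.
    by apply: cvgM; [exact: cvg_cst|exact: sc].
  by rewrite mulr0.
have lo : - (B * sin (g w - f w)) @[w --> within K (nbhs v)] --> (0 : R).
  have : - (B * sin (g w - f w)) @[w --> within K (nbhs v)] --> - (0 : R).
    exact: (cvgN up).
  by rewrite oppr0.
have cpos : \forall w \near within K (nbhs v), 0 < cos (g w - f w).
  have ccK : cos (g w - f w) @[w --> within K (nbhs v)] --> (1 : R).
    exact: cvg_within_filter.
  have FF : Filter (within K (nbhs v)) by exact: within_filter.
  exact: (@cvgr_gt R T _ FF _ _ ccK 0 ltr01).
apply: (squeeze_cvgr _ lo up); near=> w.
have Kw : K w by near: w; exact: near_withinT.
rewrite -ler_norml; apply: (link_small hB (fg w Kw)).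
apply: ltW; near: w; exact: cpos.
Unshelve. all: by end_near.
Qed.

Lemma steps_mono (R : realType) n (x : nat -> R) i j :
  steps n x -> (i <= j)%N -> (j <= n)%N -> x i <= x j.
Proof.
move=> sx ij; rewrite -(subnKC ij); elim: (j - i)%N => [|k IH].
  by rewrite addn0.
by rewrite addnS => kn; have := sx _ kn; have := IH (ltnW kn); lra.
Qed.

Lemma cost_translate (R : realType) (h : R -> R) n (x : nat -> R) (k : int) :
    (forall t, h (t + 2 * pi) = h t) ->
  cost h n (fun i => x i + (2 * pi) *~ k) = cost h n x.
Proof.
move=> hper; apply: eq_bigr => i _.
rewrite /link !(periodic_int k _ hper).
by have -> : x i.+1 + (2 * pi) *~ k - (x i + (2 * pi) *~ k) = x i.+1 - x i by lra.
Qed.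

Lemma cost_ge_of_wide_step (R : realType) (h : R -> R) (B M eta : R) n
    (x : nat -> R) i : chord_bounded B h ->
    (forall a b, pi - eta < b - a < pi -> M + n%:R * B < link h a b) ->
    steps n x -> (i < n)%N -> pi - eta < x i.+1 - x i -> M <= cost h n x.
Proof.
move=> hB hM sx iN wide; have [B0 _ _] := hB.
rewrite /cost (bigD1 (Ordinal iN)) //=.
have : M + n%:R * B < link h (x i) (x i.+1).
  by apply: hM; rewrite wide; have := sx _ iN; lra.
have : - (n%:R * B) <= \sum_(j < n | j != Ordinal iN) link h (x j) (x j.+1).
  apply: (@le_trans _ _ (\sum_(j < n | j != Ordinal iN) - B)).
    rewrite sumrN lerN2 sumr_const -[B *+ _]mulr_natl ler_wpM2r // ler_nat.
    by rewrite -[leqRHS]card_ord; exact: max_card.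
  by apply: ler_sum => j _; apply: (link_ge hB); exact: sx.
by lra.
Qed.

Definition row_seq (R : realType) q (v : 'rV[R]_q.+1) (i : nat) : R :=
  v ord0 (inord i).

(** Chains up to translation by [2 * pi], with steps bounded away from [pi] so that the conditions
    are closed. *)
Definition compact_configs (R : realType) (L eta : R) q : set 'rV[R]_q.+1 :=
  [set v | [/\ 0 <= row_seq v 0%N <= 2 * pi,
    forall i : 'I_q, 0 <= row_seq v i.+1 - row_seq v i <= pi - eta &
    row_seq v q = row_seq v 0%N + L]].

Lemma continuous_row_seq (R : realType) q i :
  continuous (fun v : 'rV[R]_q.+1 => row_seq v i).
Proof. by move=> v; exact: coord_continuous. Qed.

Lemma continuous_sub (R : realType) (T : topologicalType) (f g : T -> R) :
  continuous f -> continuous g -> continuous (fun x => f x - g x).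
Proof. by move=> fc gc x; apply: cvgB; [exact: fc|exact: gc]. Qed.

Lemma compact_configs_compact (R : realType) (L eta : R) q : 0 < eta ->
  compact (@compact_configs R L eta q).
Proof.
move=> eta0.
apply: (@subclosed_compact _ _ [set v : 'rV[R]_q.+1 |
    forall j : 'I_q.+1, `[0, 2 * pi + L]%classic (v ord0 j)]); last first.
- move=> v [v0 vs vq] j.
  have sv : steps q (row_seq v).
    by move=> i iq; have := vs (Ordinal iq); rewrite /=; lra.
  have jq : (j <= q)%N by rewrite -ltnS.
  have := steps_mono sv (leq0n j) jq; have := steps_mono sv jq (leqnn q).
  by rewrite /row_seq inord_val /= in_itv /= -/(row_seq v q) -/(row_seq v 0); lra.
- apply: (@rV_compact _ q.+1 (fun=> `[0, 2 * pi + L]%classic)) => j.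
  exact: segment_compact.
have -> : @compact_configs R L eta q =
  ((fun v => row_seq v 0%N) @^-1` `[0, 2 * pi]%classic) `&`
  (\bigcap_(i in [set: 'I_q])
    ((fun v => row_seq v i.+1 - row_seq v i) @^-1` `[0, pi - eta]%classic)) `&`
  ((fun v => row_seq v q - row_seq v 0%N) @^-1` [set L]).
  apply/seteqP; split=> v /=.
    move=> [v0 vs vq]; split; [split|].
    - by rewrite in_itv.
    - by move=> i _ /=; rewrite in_itv /=.
    - by rewrite vq addrC addKr.
  move=> [[v0 vs] vq]; split.
  - by move: v0; rewrite in_itv.
  - by move=> i; have := vs i I; rewrite /= in_itv.
  - by rewrite -vq addrC subrK.
apply: closedI; [apply: closedI|].
- apply: preimage_closed; last exact: itv_closed.
  by move=> v _; exact: continuous_row_seq.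
- apply: closed_bigI => i _; apply: preimage_closed; last exact: itv_closed.
  by move=> v _; apply: continuous_sub; exact: continuous_row_seq.
- apply: preimage_closed; last exact: closed_eq.
  by move=> v _; apply: continuous_sub; exact: continuous_row_seq.
Qed.

(** The chain [ref] with equal steps is admissible as [2 * p < q]. Chains with a step near [pi] cost
    at least as much, and the others translate into a compact set. *)
Lemma minimal_exists (R : realType) (h : R -> R) (B : R) p q : continuous h ->
    chord_bounded B h -> (forall t, h (t + 2 * pi) = h t) ->
    (forall a, 0 < h a + h (a + pi)) -> (2 * p < q)%N ->
  exists x, is_minimal h p q x.
Proof.
move=> hc hB hper hW pq.
have q0 : (0 < q)%N by lia.
have q0R : 0 < q%:R :> R by rewrite ltr0n.
have pi0 := pi_gt0 R.
set L := 2 * pi * p%:R : R.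
pose ref (i : nat) := L / q%:R * i%:R.
have ref_gap i : ref i.+1 - ref i = L / q%:R by rewrite /ref -[i.+1%:R]natr1; ring.
have gap_pi : 0 <= L / q%:R < pi.
  rewrite divr_ge0 ?(ltW q0R) ?mulr_ge0 ?(ltW pi0) //=.
  rewrite ltr_pdivrMr // /L.
  have -> : 2 * pi * p%:R = pi * (2 * p)%:R :> R by rewrite natrM; ring.
  by rewrite ltr_pM2l // ltr_nat.
have ref_q : ref q = ref 0%N + L by rewrite /ref mulr0 add0r divfK // gt_eqF.
have [W W0 hWW] := width_bound hc hper hW.
(* The term [q%:R * B] compensates the other links, each at least [- B]. *)
have [eta0 /andP[eta00 eta01] hM] := link_blowup (cost h q ref + q%:R * B) hB W0 hWW.
(* The second bound keeps [ref] inside the compact set. *)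
pose eta := Num.min eta0 (pi - L / q%:R).
have eta_gt0 : 0 < eta by rewrite /eta lt_min eta00 /=; lra.
have eta_le : eta <= eta0 by rewrite /eta ge_min lexx.
have eta_ref : L / q%:R <= pi - eta.
  have : eta <= pi - L / q%:R by rewrite /eta ge_min lexx orbT.
  by lra.
pose K : set 'rV[R]_q.+1 := @compact_configs R L eta q.
have K_of x : 0 <= x 0%N <= 2 * pi -> (forall i, (i < q)%N -> 0 <= x i.+1 - x i <= pi - eta) ->
    x q = x 0%N + L -> exists2 v, K v & forall i, (i <= q)%N -> row_seq v i = x i.
  move=> x0 xs xq; exists (\row_(j < q.+1) x j).
    split; rewrite /row_seq ?mxE ?inordK // => i.
    by rewrite !mxE !inordK ?ltnS // ?xs // ltnW.
  by move=> i iq; rewrite /row_seq mxE inordK.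
have [vref Kref refE] : exists2 v, K v & forall i, (i <= q)%N -> row_seq v i = ref i.
  apply: K_of => //; first by rewrite /ref mulr0 lexx /= mulr_ge0 // ltW.
  by move=> i _; rewrite ref_gap; lra.
have Kc : {within K, continuous (fun v => cost h q (row_seq v))}.
  apply/subspace_continuousP => v Kv.
  apply: cvg_big => [|i _]; first exact: add_continuous.
  apply: (cvg_link_within hc hB) => //; try exact: continuous_row_seq.
  by move=> w [_ ws _]; have := ws i; lra.
have [v] := compact_EVT_min (ex_intro _ _ Kref) (compact_configs_compact eta_gt0) Kc.
rewrite inE => Kv vmin; exists (row_seq v).
have vle w : K w -> cost h q (row_seq v) <= cost h q (row_seq w).
  by move=> Kw; apply: vmin; rewrite inE.
split.
  by have [_ vs vq] := Kv; split=> // i iq; have := vs (Ordinal iq); rewrite /=; lra.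
move=> y [sy yq].
have [[i [iq wide]]|narrow] := pselect (exists i, (i < q)%N /\ pi - eta < y i.+1 - y i).
  apply: le_trans (vle _ Kref) _; rewrite (eq_cost h refE).
  apply: (cost_ge_of_wide_step hB _ sy iq wide).
  by move=> a b ab; apply: hM; lra.
have [k yk] := translate_itv (y 0%N) (mulr_gt0 (ltr0Sn R 1) pi0).
have [] := K_of (fun i => y i + (2 * pi) *~ k).
- by lra.
- move=> i iq; have := sy i iq.
  have : ~ (pi - eta < y i.+1 - y i) by move=> ?; apply: narrow; exists i.
  by move=> /negP; rewrite -leNgt; lra.
- by rewrite yq -/L; lra.
by move=> w Kw wE; rewrite -(cost_translate q y k hper) -(eq_cost h wE) vle.
Qed.

(** * Areas of circumscribed polygons *)

Definition dot2 (R : realType) (u v : R * R) : R := u.1 * v.1 + u.2 * v.2.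

Lemma det2_dot2 (R : realType) (a : R) (P Q : R * R) :
  det2 P Q = dot2 (dir a) P * det2 (dir a) Q - dot2 (dir a) Q * det2 (dir a) P.
Proof.
rewrite -[LHS]mul1r -(cos2Dsin2 a) /det2 /dot2 /dir /=; ring.
Qed.

Lemma tangent_lineE (R : realType) (c : R -> R * R) (a : R) (P : R * R) :
  tangent_line c a P <-> det2 (dir a) P = - supp c a.
Proof. by rewrite /tangent_line /supp /det2 /=; split; lra. Qed.

Lemma is_vertexE (R : realType) (c : R -> R * R) (a b : R) (A : R * R) :
    0 <= b - a < pi -> is_vertex c a b A ->
  [/\ det2 (dir a) A = - supp c a, det2 (dir b) A = - supp c b &
   supp c a * dot2 (dir a) A - supp c b * dot2 (dir b) A = 2 * link (supp c) a b].
Proof.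
rewrite /is_vertex => abpi; case: eqVneq => [<- ->|ab [/tangent_lineE Aa /tangent_lineE Ab]].
  by rewrite /supp opprK link_diag mulr0 subrr.
split=> //.
have s0 : 0 < sin (b - a).
  apply: sin_gt0_pi; case/andP: abpi => h1 ->; rewrite andbT lt_neqAle h1 andbT.
  by rewrite eq_sym subr_eq0 eq_sym.
have e1 : det2 (dir b) A = cos (b - a) * det2 (dir a) A - sin (b - a) * dot2 (dir a) A.
  rewrite -[LHS]mul1r -(cos2Dsin2 a) sinB cosB /det2 /dot2 /dir /=; ring.
have e2 : det2 (dir a) A = cos (b - a) * det2 (dir b) A + sin (b - a) * dot2 (dir b) A.
  rewrite -[LHS]mul1r -(cos2Dsin2 b) sinB cosB /det2 /dot2 /dir /=; ring.
rewrite Aa Ab in e1 e2.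
have {}e1 : dot2 (dir a) A = (supp c b - supp c a * cos (b - a)) / sin (b - a).
  by apply: (mulIf (lt0r_neq0 s0)); rewrite divfK ?gt_eqF //; lra.
have {}e2 : dot2 (dir b) A = (supp c b * cos (b - a) - supp c a) / sin (b - a).
  by apply: (mulIf (lt0r_neq0 s0)); rewrite divfK ?gt_eqF //; lra.
rewrite e1 e2 /link; field; exact: lt0r_neq0.
Qed.

Lemma is_vertex_exists (R : realType) (c : R -> R * R) (a b : R) :
  0 <= b - a < pi -> exists A, is_vertex c a b A.
Proof.
move=> abpi; rewrite /is_vertex; case: eqVneq => [_|ab]; first by exists (gamma c a).
have s0 : sin (b - a) != 0.
  apply: lt0r_neq0; apply: sin_gt0_pi; case/andP: abpi => h1 ->; rewrite andbT lt_neqAle h1 andbT.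
  by rewrite eq_sym subr_eq0 eq_sym.
exists (side (supp c) a b * cos a + supp c a * sin a,
        side (supp c) a b * sin a - supp c a * cos a).
split; apply/tangent_lineE; rewrite /det2 /dir /=.
  by rewrite -[RHS]mul1r -(cos2Dsin2 a); ring.
have E : side (supp c) a b * sin (b - a) + supp c a * cos (b - a) = supp c b.
  by rewrite /side divfK // subrK.
by rewrite -E sinB cosB; ring.
Qed.

(** Consecutive vertices share the tangent of direction [theta i.+1]. In its frame their determinant
    is twice a link plus a difference that telescopes around the polygon. *)
Lemma algebraic_areaE (R : realType) (c : R -> R * R) p q (theta : nat -> R) A :
  circumscribed c p q theta A -> algebraic_area q A = cost (supp c) q theta.
Proof.
move=> [st rot vx].
have hp (U : Type) (f : R -> U) : (forall t, f (t + 2 * pi) = f t) -> f (theta q) = f (theta 0%N).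
  move=> fper; rewrite rot mulr_natr; exact: (@periodic_int _ _ f _ p _ fper).
have dirp : dir (theta q) = dir (theta 0%N).
  apply: hp => t; have -> : 2 * pi = pi *+ 2 :> R by rewrite mulr_natl.
  by rewrite /dir cosD2pi sinD2pi.
have suppp : supp c (theta q) = supp c (theta 0%N) by apply: hp => t; exact: supp_periodic.
(* Reducing the index of the vertex modulo [q] makes [V q = V 0]. *)
pose V i := supp c (theta i) * dot2 (dir (theta i)) (A (i %% q)%N).
have Vq : V q = V 0%N by rewrite /V suppp dirp modnn mod0n.
have key (i : 'I_q) : det2 (A i) (A (i.+1 %% q)%N) =
    2 * link (supp c) (theta i) (theta i.+1) + (V i.+1 - V i).
  have q0 : (0 < q)%N by case: q i {V Vq st rot vx dirp suppp hp} => // -[].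
  have [Ai Ai1 Al] := is_vertexE (st i (ltn_ord i)) (vx i (ltn_ord i)).
  have Bi1 : det2 (dir (theta i.+1)) (A (i.+1 %% q)%N) = - supp c (theta i.+1).
    have [iq|iq] := ltnP i.+1 q.
      rewrite modn_small //.
      by have [] := is_vertexE (st _ iq) (vx _ iq).
    have -> : i.+1 = q by have := ltn_ord i; lia.
    rewrite modnn dirp suppp.
    by have [] := is_vertexE (st _ q0) (vx _ q0).
  rewrite (det2_dot2 (theta i.+1)) Ai1 Bi1 -Al /V (modn_small (ltn_ord i)).
  by ring.
rewrite /algebraic_area (eq_bigr _ (fun i _ => key i)) big_split /=.
have -> : \sum_(i < q) (V i.+1 - V i) = 0.
  by rewrite -(big_mkord xpredT (fun i => V i.+1 - V i)) telescope_sumr // Vq subrr.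
by rewrite addr0 -mulr_sumr mulrA mulVf ?mul1r // pnatr_eq0.
Qed.

Lemma circumscribed_areasE (R : realType) (c : R -> R * R) p q :
  circumscribed_areas c p q = [set cost (supp c) q x | x in [set x | config p q x]].
Proof.
apply/seteqP; split=> a /=.
  move=> [x [A [cx ->]]]; exists x; last by rewrite (algebraic_areaE cx).
  by have [sx xq _] := cx.
move=> [x [sx xq] <-]; exists x.
have vx i : {A | (i < q)%N -> is_vertex c (x i) (x i.+1) A}.
  apply: cid; have [iq|_] := ltnP i q; last by exists 0.
  by have [A hA] := is_vertex_exists c (sx i iq); exists A.
exists (fun i => sval (vx i)).
have cx : circumscribed c p q x (fun i => sval (vx i)).
  by split=> // i iq; apply: (svalP (vx i)).
by split=> //; rewrite (algebraic_areaE cx).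
Qed.

Lemma supp_tangential (R : realType) (c : R -> R * R) (T : R) :
  smooth_strictly_convex_closed c T -> tangential (supp c) (dsupp c).
Proof.
move=> hc; split=> [t|t b tb btpi]; first exact: (is_derive_supp t hc).
by apply: (supp_tangent_lt hc); rewrite gt_eqF // sinB_gt0.
Qed.

Theorem mainTheorem3 (R : realType) (c : R -> R * R) (T : R)
    (hc : smooth_strictly_convex_closed c T) :
  exists Q : nat -> nat -> R,
    (forall p q : nat, (1 <= p)%N -> (1 <= q)%N -> (2 * p < q)%N ->
       is_minimum (circumscribed_areas c p q) (Q p q)) /\
    (forall p q : nat, (1 <= p)%N -> (1 <= q)%N -> coprime p q ->
       (2 * p < q.-1)%N ->
       Q p q.-1 + Q p q.+1 > 2 * Q p q).
Proof.
have hh : sine_convex (supp c) by exact: supp_sine_convex hc.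
have he : tangential (supp c) (dsupp c) by exact: supp_tangential hc.
have hper t : supp c (t + 2 * pi) = supp c t by exact: supp_periodic.
have [B [B0 hB hL]] := supp_bounded hc.
have hcont : continuous (supp c).
  by apply: derivable1_continuous => t; case: (is_derive_supp t hc).
have ex p q : {x | (2 * p < q)%N -> is_minimal (supp c) p q x}.
  apply: cid; have [pq|_] := ltnP (2 * p) q; last by exists (fun=> 0).
  have [x mx] := minimal_exists hcont (And3 B0 hB hL) hper (fun a => supp_width a hc) pq.
  by exists x.
pose x p q := sval (ex p q).
have xP p q : (2 * p < q)%N -> is_minimal (supp c) p q (x p q) := svalP (ex p q).
exists (fun p q => cost (supp c) q (x p q)); split=> [p q _ _ pq|p q p1 q1 _ pq].
  have [cx mx] := xP p q pq; rewrite circumscribed_areasE; split; first by exists (x p q).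
  by move=> _ [y cy <-]; exact: mx.
(* With [q = n + 1], the neighbours [q - 1] and [q + 1] become [n] and [n + 2]. *)
case: q q1 pq => // n _ /= pn.
apply: (minimal_cost_convex hh he hper p1); [lia| | |]; apply: xP; lia.
Qed.
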